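(* We have $f(3)\le 3$ and $f(4)\le 5$. Consequently, for every $\varepsilon>0$ there exists $c=c(\varepsilon)>0$ such that the following hold. (i) For every $n$-vertex ordered graph $G$ with no induced monotone $P_6$, if $\varrho_3(\overline{G})>\varepsilon$, then $\overline{G}$ contains a $K_2\big[\tfrac{cn}{\log n}\big]$. (ii) For every $n$-vertex ordered graph $G$ with no induced monotone $P_8$, if $\varrho_5(\overline{G})>\varepsilon$, then $\overline{G}$ contains a $K_2\big[\tfrac{cn}{\log n}\big]$.
   Context: All graphs are finite and simple. An ordered graph is a graph with a total ordering $<$ on its vertex set. A monotone path $P_m$ is an ordered graph with vertices $v_1<\dots<v_m$ in which $v_i,v_j$ are adjacent if and only if $|i-j|=1$; an ordered graph $G$ has no induced monotone $P_m$ if there are no vertices $v_1<\dots<v_m$ of $G$ such that $v_iv_j\in E(G)$ if and only if $|i-j|=1$. $\overline{G}$ is the complement of $G$. $\varrho_r(G)$ is the number of copies of $K_r$ in $G$ divided by $\binom{|V(G)|}{r}$. $K_2[t]=K_{t,t}$, contained as a not necessarily induced subgraph; for non-integer $t$ read $\lfloor t\rfloor$. Definition of $f$. Let $\chi$ be a red-blue edge-coloring of the ordered clique with vertices $v_1<\dots<v_k$. Its dependency digraph $D=D(\chi)$ has vertex set $\{v_1,\dots,v_k\}$, and its directed edges are exactly the following: for every $i\in\{1,\dots,k-1\}$ and $j\in\{1,\dots,k\}\setminus\{i,i+1\}$, if $\chi(v_iv_{i+1})=\mathrm{red}$ and $\chi(v_iv_j)=\chi(v_{i+1}v_j)=\mathrm{blue}$,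 then $D$ contains the directed edges $(v_j,v_i)$ and $(v_j,v_{i+1})$. (A pair of opposite edges counts as a directed cycle of length two.) $\chi$ is admissible if $D(\chi)$ is acyclic. For $k\ge1$, $f(k)$ is the minimum integer $N$ such that in any red-blue edge-coloring of the ordered clique on $N$ vertices there exist $k$ vertices such that the coloring induced on these $k$ vertices (with the inherited vertex ordering and edge colors) is admissible. *)

(* Defs.v *)
From HB Require Import structures.
From mathcomp Require Import all_boot all_order all_algebra.
From mathcomp Require Import boolp reals exp.

Set Implicit Arguments.
Unset Strict Implicit.
Unset Printing Implicit Defensive.

Import Order.TTheory GRing.Theory Num.Theory.

(* The ordered clique on v_1 < ... < v_k has vertex set 'I_k (v_i is i - 1), and
   the color of the edge v_i v_j is [chi [set i; j]]; the values of a coloring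
   on sets that are not of size 2 are never used. *)
Definition coloring (k : nat) := {set 'I_k} -> bool.

Notation red := true (only parsing).
Notation blue := false (only parsing).

Definition dependency_digraph (k : nat) (chi : coloring k) : rel 'I_k :=
  fun x y => [exists i : 'I_k, exists i' : 'I_k,
    [&& (i' : nat) == i.+1, x != i, x != i',
        chi [set i; i'] == red,
        chi [set i; x] == blue, chi [set i'; x] == blue
      & (y == i) || (y == i')]].

(* [ucycle] includes cycles of length two (and would include loops). *)
Definition acyclic (T : eqType) (D : rel T) : Prop :=
  forall s : seq T, s != [::] -> ~ ucycle D s.

Definition admissible (k : nat) (chi : coloring k) : Prop :=
  acyclic (dependency_digraph chi).

Definition increasing (k : nat) d (T : porderType d) (v : 'I_k -> T) : Prop :=
  {homo v : i j / (i < j)%N >-> (i < j)%O}.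

Definition induced_coloring (k N : nat) (v : 'I_k -> 'I_N) (chi : coloring N) :
  coloring k := fun e => chi [set v x | x in e].

Definition forces_admissible (k N : nat) : Prop :=
  forall chi : coloring N,
    exists2 v : 'I_k -> 'I_N,
      increasing v & admissible (induced_coloring v chi).

Definition monochromatic (N : nat) (chi : coloring N) (c : bool)
    (A : {set 'I_N}) : Prop :=
  forall x y, x \in A -> y \in A -> x != y -> chi [set x; y] = c.

Lemma ramsey (a b : nat) : exists N : nat,
  forall (n : nat) (chi : coloring n) (S : {set 'I_n}), (N <= #|S|)%N ->
    (exists A : {set 'I_n},
        [/\ A \subset S, #|A| = a & monochromatic chi red A]) \/
    (exists A : {set 'I_n},
        [/\ A \subset S, #|A| = b & monochromatic chi blue A]).
Proof.
have mono0 n (chi : coloring n) c : monochromatic chi c set0.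
  by move=> x y; rewrite inE.
have step n (chi : coloring n) c x A : monochromatic chi c A ->
    (forall y, y \in A -> chi [set x; y] = c) -> monochromatic chi c (x |: A).
  move=> mA xA y z; rewrite !inE => /orP[/eqP->|yA] /orP[/eqP->|zA] ne.
  - by rewrite eqxx in ne.
  - exact: xA.
  - by rewrite setUC; exact: xA.
  - exact: mA.
elim: a b => [b|a IHa].
  by exists 0%N => n chi S _; left; exists set0; rewrite sub0set cards0; split.
elim=> [|b [N2 H2]].
  by exists 0%N => n chi S _; right; exists set0; rewrite sub0set cards0; split.
have [N1 H1] := IHa b.+1.
exists (N1 + N2).+1 => n chi S leS.
have /card_gt0P[x xS] : (0 < #|S|)%N by apply: leq_trans leS.
pose S1 := [set y in S :\ x | chi [set x; y] == red].
pose S2 := [set y in S :\ x | chi [set x; y] == blue].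
have sub1 : S1 \subset S by apply/subsetP=> y; rewrite !inE => /andP[/andP[]].
have sub2 : S2 \subset S by apply/subsetP=> y; rewrite !inE => /andP[/andP[]].
have cS : #|S| = (#|S1| + #|S2|).+1.
  rewrite (cardsD1 x) xS add1n; congr _.+1.
  rewrite -(cardsID [set y | chi [set x; y]] (S :\ x)); congr (_ + _)%N;
    apply: eq_card => y; rewrite !inE; first by rewrite eqb_id.
  by rewrite eqbF_neg andbC.
have ext c (A S' : {set 'I_n}) m : S' = [set y in S :\ x | chi [set x; y] == c] ->
    A \subset S' -> #|A| = m -> monochromatic chi c A ->
    [/\ x |: A \subset S, #|x |: A| = m.+1 & monochromatic chi c (x |: A)].
  move=> -> /subsetP sA cA mA; split.
  - apply/subsetP=> y; rewrite !inE => /orP[/eqP->//|/sA].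
    by rewrite !inE => /andP[/andP[]].
  - rewrite cardsU1 cA; suff -> : x \notin A by [].
    by apply/negP => /sA; rewrite !inE eqxx.
  - by apply: step => // y /sA; rewrite inE => /andP[_ /eqP].
have [le1|lt1] := leqP N1 #|S1|.
  have [[A [sA cA mA]]|[A [sA cA mA]]] := H1 n chi S1 le1.
    by left; exists (x |: A); apply: ext (erefl _) sA cA mA.
  by right; exists A; split=> //; apply: subset_trans sA sub1.
have le2 : (N2 <= #|S2|)%N.
  rewrite leqNgt; apply/negP => lt2.
  move: leS; rewrite cS ltnS leqNgt => /negP; apply.
  by rewrite -addnS leq_add // ltnW.
have [[A [sA cA mA]]|[A [sA cA mA]]] := H2 n chi S2 le2.
  by left; exists A; split=> //; apply: subset_trans sA sub2.
by right; exists (x |: A); apply: ext (erefl _) sA cA mA.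
Qed.

(* Monochromatic colorings have an empty dependency digraph, so the minimum
   defining [f] exists by Ramsey's theorem. *)
Lemma forces_admissible_exists (k : nat) :
  exists N : nat, `[< forces_admissible k N >].
Proof.
have [N H] := ramsey k k; exists N; apply/asboolP => chi.
have [A [c [cA mA]]] : exists (A : {set 'I_N}) c,
    #|A| = k /\ monochromatic chi c A.
  have [|[A []]|[A []]] := H N chi [set: 'I_N]; first by rewrite cardsT card_ord.
    by exists A, red.
  by exists A, blue.
case: k / cA {H}.
exists (@Order.enum_val _ _ A) => [i j ltij|].
  rewrite lt_neqAle Order.le_enum_val; last exact: le_total.
  rewrite (inj_eq (@Order.enum_val_inj _ _ _)) leEord (ltnW ltij) andbT.
  by apply: contraTneq ltij => ->; rewrite ltnn.
have col x y : x != y ->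
    induced_coloring (@Order.enum_val _ _ A) chi [set x; y] = c.
  move=> ne; rewrite /induced_coloring imsetU1 imset_set1.
  by apply: mA; rewrite ?Order.enum_valP // (inj_eq (@Order.enum_val_inj _ _ _)).
case=> // x s _ /andP[] /=.
suff nD u w : ~~ dependency_digraph
    (induced_coloring (@Order.enum_val _ _ A) chi) u w.
  by case: s => [|y s] /=; rewrite (negPf (nD _ _)).
apply/negP => /existsP[i /existsP[i' /and5P[/eqP ii' ui ui' /eqP r]]].
move=> /andP[/eqP b _].
move: r b; rewrite !col // 1?eq_sym //; first by move=> ->.
by rewrite -val_eqE /= ii' gtn_eqF.
Qed.

Definition f (k : nat) : nat := ex_minn (forces_admissible_exists k).

Definition simple_graph (T : finType) (e : rel T) : Prop :=
  symmetric e /\ irreflexive e.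

Definition complement (T : finType) (e : rel T) : rel T :=
  fun x y => (x != y) && ~~ e x y.

Definition has_induced_monotone_path (m : nat) d (T : finOrderType d)
    (e : rel T) : Prop :=
  exists2 v : 'I_m -> T, increasing v
    & forall i j : 'I_m,
        e (v i) (v j) = ((j : nat) == i.+1) || ((i : nat) == j.+1).

Definition is_clique (T : finType) (e : rel T) (A : {set T}) : bool :=
  [forall x in A, forall y in A, (x != y) ==> e x y].

(* If #|T| < r then the value is 0 / 0 = 0. *)
Definition clique_density (R : realType) (r : nat) (T : finType) (e : rel T) : R :=
  ((#|[set A : {set T} | (#|A| == r) && is_clique e A]|)%:R / 'C(#|T|, r)%:R)%R.

Definition contains_biclique (t : nat) (T : finType) (e : rel T) : Prop :=
  exists A B : {set T},
    [/\ [disjoint A & B], #|A| = t, #|B| = t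
      & forall x y, x \in A -> y \in B -> e x y].

(* Main.v *)
(* Suppose that the complement of G has no K_{t,t} with t about n / log n.

   In a linear-sized set of small maximum degree, sets of fewer than t vertices
   double their neighbourhood from one block of vertices to the next one on the
   right, so after log n blocks a single vertex reaches almost everything by
   monotone paths. Gyarfas' path argument then gives arbitrarily long induced
   monotone paths. Hence every linear-sized set has positive edge density.

   An energy increment that also keeps track of the density of independent
   r-tuples gives linear-sized parts A_1 < ... < A_r, pairwise regular and
   pairwise of density bounded away from 1. Color a pair of parts red if its
   density is tiny. If k of the parts span an admissible coloring, an induced
   monotone path with two vertices x_i, y_i in the i-th of them is embedded
   greedily, where x_i, y_i come from a dense regular pair inside that part. Dense
   requirements are met one vertex at a time. When the parts i and i+1 form a red
   pair, the edge y_i x_{i+1} exists because there is no K_{t,t}, but both ends are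
   then fixed at once, and the vertices of a part j that is blue to both must have
   been chosen before: this is the dependency digraph, and a topological order of
   it is a valid order of embedding. *)

Require Import Defs.
From HB Require Import structures.
From mathcomp Require Import all_boot all_order all_algebra.
From mathcomp Require Import boolp reals exp.
From mathcomp Require Import zify ring lra.

Set Implicit Arguments.
Unset Strict Implicit.
Unset Printing Implicit Defensive.

Import Order.TTheory GRing.Theory Num.Theory.
Local Open Scope ring_scope.

(** * Monotone paths in sparse ordered graphs *)

Lemma split_low d (T : finOrderType d) (W : {set T}) a : (a <= #|W|)%N ->
  exists J : {set T}, [/\ J \subset W, #|J| = a &
    forall x y, x \in J -> y \in W :\: J -> (x < y)%O].
Proof.
elim: a => [|a IHa] leaW.
  exists set0; split; [exact: sub0set | exact: cards0 |].
  by move=> x y; rewrite in_set0.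
have [J [sJW cJ ltJ]] := IHa (ltnW leaW).
have /card_gt0P[z0 z0W] : (0 < #|W :\: J|)%N.
  by rewrite cardsD (setIidPr sJW) cJ subn_gt0.
case: (@Order.TotalTheory.arg_minP _ _ _ z0 (mem (W :\: J)) id z0W) => z zW minz.
have /setDP[zW0 zJ] := zW.
exists (z |: J); split.
- by rewrite subUset sJW sub1set zW0.
- by rewrite cardsU1 zJ cJ.
- move=> x y; rewrite !inE negb_or => /orP[/eqP->|xJ] /andP[/andP[yz yJ] yW].
    by rewrite lt_neqAle eq_sym yz; apply: minz; apply/setDP.
  by apply: ltJ => //; rewrite inE yJ.
Qed.

Definition all_lt d (T : finPOrderType d) (A B : {set T}) : Prop :=
  forall x y, x \in A -> y \in B -> (x < y)%O.

Lemma all_lt_sub d (T : finPOrderType d) (A B A' B' : {set T}) :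
  all_lt A B -> A' \subset A -> B' \subset B -> all_lt A' B'.
Proof. by move=> ltAB /subsetP sA /subsetP sB x y /sA xA /sB; apply: ltAB. Qed.

(** [all_lt] makes the sets disjoint, so without an edge any [t] vertices from each side span a
    biclique in the complement. *)
Lemma edge_between d (T : finOrderType d) (e : rel T) t (A B : {set T}) :
  ~ contains_biclique t (complement e) -> (t <= #|A|)%N -> (t <= #|B|)%N ->
  all_lt A B -> exists x y, [/\ x \in A, y \in B & e x y].
Proof.
move=> nb tA tB ltAB.
case: (boolP [exists x, exists y, [&& x \in A, y \in B & e x y]]).
  by case/existsP=> x /existsP[y /and3P[? ? ?]]; exists x, y.
move=> /existsPn ne; case: nb.
have [A1 [sA cA _]] := split_low tA.
have [B1 [sB cB _]] := split_low tB.
exists A1, B1; split=> //.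
  rewrite -setI_eq0; apply/eqP/setP=> x; rewrite !inE; apply/negP=> /andP[xA xB].
  by have := ltAB x x (subsetP sA _ xA) (subsetP sB _ xB); rewrite ltxx.
move=> x y /(subsetP sA) xA /(subsetP sB) yB; rewrite /complement.
have := ltAB x y xA yB; rewrite lt_neqAle => /andP[-> _] /=.
by have /existsPn/(_ y) := ne x; rewrite xA yB.
Qed.

Section MonotoneReach.
Context {d : Order.disp_t} {T : finOrderType d} (e : rel T).

(** Only the endpoint of a step has to lie in [U], so a path may start at a vertex already deleted
    from [U]. *)
Definition mono_step (U : {set T}) : rel T :=
  fun x y => [&& e x y, (x < y)%O & y \in U].

Definition nbrs (A B : {set T}) : {set T} := [set y in B | [exists x in A, e x y]].

Definition unreached (U S J : {set T}) : {set T} :=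
  [set x in J | ~~ [exists s in S, connect (mono_step U) s x]].

Lemma nbrsU A1 A2 B : nbrs (A1 :|: A2) B = nbrs A1 B :|: nbrs A2 B.
Proof.
apply/setP=> y; rewrite !inE -andb_orr; congr (_ && _).
apply/existsP/orP=> [[x]|[/existsP[x /andP[xA exy]]|/existsP[x /andP[xA exy]]]].
- rewrite inE => /andP[/orP[xA|xA] exy]; [left|right]; apply/existsP; exists x;
    by rewrite xA.
- by exists x; rewrite inE xA.
- by exists x; rewrite inE xA orbT.
Qed.

Lemma nbrs_large t (A B : {set T}) : ~ contains_biclique t (complement e) ->
  all_lt A B -> (t <= #|A|)%N -> (#|B| < #|nbrs A B| + t)%N.
Proof.
move=> nb ltAB tA.
have sN : nbrs A B \subset B by apply/subsetP=> y; rewrite inE => /andP[].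
have -> : #|B| = (#|nbrs A B| + #|B :\: nbrs A B|)%N.
  by rewrite -(cardsID (nbrs A B) B) (setIidPr sN).
rewrite ltn_add2l ltnNge; apply/negP=> tB.
have [|x [y [xA]]] := edge_between nb tA tB.
  by move=> x y xA; rewrite inE => /andP[_]; apply: ltAB.
rewrite !inE => /andP[/negP ny yB] exy; apply: ny; rewrite yB /=.
by apply/existsP; exists x; rewrite xA.
Qed.

Lemma unreached_base t (U S J J2 : {set T}) :
  ~ contains_biclique t (complement e) -> S \subset J -> J2 \subset U ->
  all_lt J J2 -> (t <= #|S|)%N -> (#|unreached U S J2| < t)%N.
Proof.
move=> nb sSJ sJ2U ltJ tS; rewrite ltnNge; apply/negP=> tU.
have sub : unreached U S J2 \subset J2 by apply/subsetP=> y; rewrite inE => /andP[].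
have [|x [y [xS]]] := edge_between nb tS tU; first exact: all_lt_sub ltJ _ _.
rewrite inE => /andP[yJ2 /existsP ny] exy; apply: ny; exists x; rewrite xS /=.
apply: connect1; rewrite /mono_step exy (ltJ x y) //; last exact: (subsetP sSJ).
exact: (subsetP sJ2U).
Qed.

(* Below the threshold t, sets double their neighbourhood in each of the
   successive blocks of J, so that single vertices of the lowest block reach t
   vertices after log t blocks. *)
Lemma expansion t l (U J J2 : {set T}) :
  ~ contains_biclique t (complement e) ->
  J \subset U -> J2 \subset U -> all_lt J J2 -> (6 * t * l.+1 <= #|J|)%N ->
  exists B : {set T}, [/\ B \subset J, (5 * t <= #|B|)%N &
    forall S : {set T}, S \subset B -> (t <= #|S| * 2 ^ l)%N ->
      (#|unreached U S J2| < t)%N].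
Proof.
move=> nb; elim: l J => [|l IHl] J sJU sJ2U ltJ cJ.
  exists J; split=> //; first lia.
  by move=> S sS; rewrite expn0 muln1; apply: (unreached_base nb sS).
have [|J0 [sJ0 cJ0 ltJ0]] := @split_low _ _ J (6 * t); first lia.
have cJ1 : #|J :\: J0| = (#|J| - 6 * t)%N by rewrite cardsD (setIidPr sJ0) cJ0.
have sJ1 : J :\: J0 \subset J by apply: subsetDl.
have [||||B1 [sB1 cB1 hB1]] := IHl (J :\: J0) => //.
- exact: subset_trans sJU.
- by move=> x y xJ; apply: ltJ; apply: (subsetP sJ1).
- by rewrite cJ1; move: cJ; clear; lia.
have ltB1 (A : {set T}) : A \subset J0 -> all_lt A B1.
  by move=> sA; apply: (all_lt_sub (A := J0) (B := J :\: J0)).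
(* A largest set that fails to double is removed from [J0]; a further such set in the remainder
   could be joined to it. *)
pose small (X : {set T}) :=
  [&& X \subset J0, #|X| <= t & #|nbrs X B1| <= 2 * #|X|]%N.
have small0 : small set0.
  rewrite /small sub0set cards0 /= muln0 leqn0 cards_eq0; apply/eqP/setP=> y.
  by rewrite !inE; apply/negP=> /andP[_ /existsP[x]]; rewrite inE.
have [X [/and3P[sX cX nX] maxX]] : exists X : {set T},
    small X /\ forall S : {set T}, small S -> (#|S| <= #|X|)%N.
  case: (@arg_maxnP _ set0 small (fun X : {set T} => #|X|) small0) => X sX maxX.
  by exists X.
exists (J0 :\: X); split.
- by apply: subset_trans sJ0; apply: subsetDl.
- by rewrite cardsD (setIidPr sX) cJ0; move: cX; clear; lia.
move=> S sS tS; have sSJ0 : S \subset J0 by apply: subset_trans sS (subsetDl _ _).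
have [leS|ltS] := leqP t #|S|.
  by apply: (unreached_base nb (subset_trans sSJ0 sJ0)).
have S_gt0 : (0 < #|S|)%N by rewrite lt0n; apply/eqP=> S0; move: tS ltS; rewrite S0; clear; lia.
have dXS : X :&: S = set0.
  apply/setP=> y; rewrite !inE; apply/negP=> /andP[yX /(subsetP sS)].
  by rewrite inE yX.
have cXS : #|X :|: S| = (#|X| + #|S|)%N by rewrite cardsU dXS cards0 subn0.
have sXS : X :|: S \subset J0 by rewrite subUset sX.
have nXS : (#|nbrs (X :|: S) B1| <= #|nbrs X B1| + #|nbrs S B1|)%N.
  by rewrite nbrsU cardsU leq_subr.
have expand : (2 * #|S| <= #|nbrs S B1|)%N.
  (* If the union has more than [t] vertices, it sees over [4 * t] vertices of [B1], at most [2 * t]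
     of them through [X]. Otherwise the union doubles by maximality of [X], and [X] accounts for at
     most [2 * #|X|]. *)
  have [leXS|ltXS] := leqP #|X :|: S| t; last first.
    have := nbrs_large nb (ltB1 _ sXS) (ltnW ltXS).
    by move: nXS nX cX ltS cB1; clear; lia.
  have [leN|ltN] := leqP #|nbrs (X :|: S) B1| (2 * #|X :|: S|); last first.
    by move: ltN nXS nX cXS; clear; lia.
  have : small (X :|: S) by apply/and3P.
  by move/maxX; move: S_gt0 cXS; clear; lia.
apply: leq_ltn_trans (hB1 (nbrs S B1) _ _); last 2 first.
- by apply/subsetP=> y; rewrite inE => /andP[].
- by apply: leq_trans tS _; rewrite expnS mulnA leq_mul2r mulnC expand orbT.
apply/subset_leq_card/subsetP=> y; rewrite !inE => /andP[-> /existsP ny] /=.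
apply/existsP=> -[z /andP[]]; rewrite inE => /andP[zB1 /existsP[s /andP[sS' esz]]] zy.
apply: ny; exists s; rewrite sS' /=; apply: connect_trans zy; apply: connect1.
rewrite /mono_step esz (ltB1 _ sSJ0) //=; apply: (subsetP sJU); apply: (subsetP sJ1).
exact: (subsetP sB1).
Qed.

(** A vertex is compared only with later ones, and by order only with the next; transitivity and
    symmetry of the graph give the rest. *)
Fixpoint ind_path (s : seq T) : bool :=
  if s is x :: s' then
    (if s' is y :: s'' then [&& e x y, (x < y)%O & all (fun z => ~~ e x z) s'']
     else true) && ind_path s'
  else true.

Lemma ind_path_nth x0 s i j : ind_path s -> (i < j < size s)%N ->
  (nth x0 s i < nth x0 s j)%O && (e (nth x0 s i) (nth x0 s j) == (j == i.+1)).
Proof.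
elim: s i j => [|x s IHs] i j; first by rewrite ltn0 andbF.
move=> /andP[hx hs] /andP[].
case: j => // j; rewrite !ltnS => leij ltj; rewrite /= eqSS.
case: i leij => [|i] ltij; last by rewrite IHs // ltij.
have {hx}[y [s' [E exy ltxy /allP ns]]] : exists y s',
    [/\ s = y :: s', e x y, (x < y)%O & all (fun z => ~~ e x z) s'].
  by case: s hx hs ltj {IHs} => // y s /and3P[? ? ?] _ _; exists y, s.
subst s; case: j ltj {ltij} => [|j] ltj /=; first by rewrite ltxy exy.
rewrite (negPf (ns _ _)) ?mem_nth // eqxx andbT (lt_trans ltxy) //.
by have /andP[] := IHs 0%N j.+1 hs ltj.
Qed.

(** Take the last vertex adjacent to [v] on a monotone path from [v] to [g]; the first step provides
    one. The path beyond it avoids the neighbourhood of [v]. *)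
Lemma last_neighbour (U : {set T}) v g : connect (mono_step U) v g -> v != g ->
  exists w, [/\ w \in U, e v w, (v < w)%O &
    connect (mono_step (U :\: [set z | e v z])) w g].
Proof.
set U' := U :\: _.
have split_at p x : path (mono_step U) x p -> path (mono_step U') x p \/
    exists w, [/\ w \in U, e v w, (x < w)%O &
      connect (mono_step U') w (last x p)].
  elim: p x => [|y p IHp] x /=; first by left.
  move=> /andP[/and3P[exy ltxy yU] pp].
  have [pp'|[w [wU evw ltyw cw]]] := IHp y pp; last first.
    by right; exists w; split=> //; apply: lt_trans ltyw.
  have [evy|nevy] := boolP (e v y).
    by right; exists y; split=> //; apply/connectP; exists p.
  by left; rewrite pp' andbT /mono_step exy ltxy !inE yU nevy.
move=> /connectP[p pp ->] {g} ne.
have [|[w [*]]] := split_at p v pp; last by exists w.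
case: p pp ne => [|w p] /=; first by rewrite eqxx.
move=> /andP[/and3P[evw ltvw wU] pp] _ /andP[/and3P[_ _]].
by rewrite !inE evw.
Qed.

(* Gyarfas' path argument: v is extended by its last neighbour w on a monotone
   path from v to a vertex that still reaches almost all of the next block
   after the neighbourhood of v has been deleted. *)
Lemma grow_path t l D m (U J Z : {set T}) v :
  ~ contains_biclique t (complement e) -> (0 < t <= 2 ^ l)%N ->
  J \subset U -> Z \subset U -> all_lt J Z ->
  (forall x, x \in U -> #|U :&: [set y | e x y]| <= D)%N ->
  (#|U :&: [set y | e v y]| <= D)%N ->
  (6 * t * l.+1 + D <= #|J|)%N -> (m * (6 * t * l.+1 + 2 * D) <= #|Z|)%N ->
  v \notin J -> (#|unreached U [set v] J| < t)%N ->
  exists s, [/\ size s = m, {subset s <= U} & ind_path (v :: s)].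
Proof.
move=> nb /andP[t_gt0 let2]; elim: m U J Z v => [|m IHm] U J Z v sJU sZU ltJZ dU dv
    cJ cZ vJ rv; first by exists [::].
set N := [set y | e v y].
have dN (A : {set T}) : A \subset U -> (#|A| <= #|A :\: N| + D)%N.
  move=> sA; rewrite -(cardsID N A) addnC leq_add2l; apply: leq_trans dv.
  by apply/subset_leq_card/setSI.
(* The block exceeds the need of [expansion] by [D], since the neighbours of the next path vertex
   will be deleted from it. A round costs [Z] this block and at most [D] neighbours of [v]. *)
have [|J2 [sJ2 cJ2 ltJ2]] := @split_low _ _ (Z :\: N) (6 * t * l.+1 + D).
  have := dN Z sZU; move: cZ; clear; lia.
have cZ2 := cardsD (Z :\: N) J2; rewrite (setIidPr sJ2) cJ2 in cZ2.
have sJ2U : J2 \subset U :\: N by apply: subset_trans sJ2 (setSD _ _).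
have sub1 : J :\: N \subset J by apply: subsetDl.
have ltJJ2 : all_lt (J :\: N) J2.
  apply: all_lt_sub ltJZ sub1 _; exact: subset_trans sJ2 (subsetDl _ _).
have [|B [sB cB hB]] := expansion (l := l) nb (setSD N sJU) sJ2U ltJJ2.
  have := dN J sJU; move: cJ; clear; lia.
(* [B] has at least [5 * t] vertices and [v] misses fewer than [t] vertices of [J]. *)
have /subsetPn[g gB] : ~~ (B \subset unreached U [set v] J).
  by apply/negP => /subset_leq_card; move: t_gt0 rv cB; clear; lia.
have gJ : g \in J by apply: (subsetP sub1); apply: (subsetP sB).
rewrite inE gJ /= negbK => /existsP[v' /andP[/set1P-> cvg]].
have [|w [wU evw ltvw cwg]] := last_neighbour cvg.
  by apply: contraNneq vJ => ->.
have wJ2 : w \notin J2.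
  by apply/negP=> /(subsetP sJ2U); rewrite !inE evw.
have sUN : U :\: N \subset U by apply: subsetDl.
have dUN x : (#|(U :\: N) :&: [set y | e x y]| <= #|U :&: [set y | e x y]|)%N.
  by apply/subset_leq_card/setSI.
have [|||||||||s [cs sU ps]] := IHm (U :\: N) J2 ((Z :\: N) :\: J2) w => //.
- by apply: subset_trans (subsetDl _ _) (setSD _ _).
- by move=> x xU; apply: leq_trans (dUN x) (dU _ (subsetP sUN _ xU)).
- by apply: leq_trans (dUN w) (dU _ wU).
- by rewrite cJ2.
- have := dN Z sZU; move: cZ cZ2; clear; lia.
(* [w] reaches [g] inside [U :\: N], hence all that [g] reaches; [hB] applies to the singleton of
   [g] because [t <= 2 ^ l]. *)
- apply: leq_ltn_trans (hB [set g] _ _); last 2 first.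
  + by rewrite sub1set.
  + by rewrite cards1 mul1n.
  apply/subset_leq_card/subsetP=> y; rewrite !inE => /andP[-> /existsP ny] /=.
  apply/existsP=> -[z /andP[/set1P-> gy]]; apply: ny; exists w.
  by rewrite inE eqxx (connect_trans cwg gy).
exists (w :: s); split=> [|x|].
- by rewrite /= cs.
- by rewrite inE => /orP[/eqP->//|/sU /(subsetP sUN)].
- have {}sU : all (fun z => ~~ e v z) s.
    by apply/allP=> z /sU; rewrite !inE => /andP[].
  by rewrite [ind_path _]/= in ps *; rewrite evw ltvw sU.
Qed.
End MonotoneReach.

Lemma ind_pathW d (T : finOrderType d) (e : rel T) (s : seq T) :
  simple_graph e -> ind_path e s -> has_induced_monotone_path (size s) e.
Proof.
move=> [sym irr]; case: s => [|x0 s] ps.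
  by exists (fun i : 'I_0 => False_rect T (notF (ltn_ord i))) => -[].
set s' := x0 :: s in ps *.
have hlt (i j : 'I_(size s')) : (i < j)%N ->
    (nth x0 s' i < nth x0 s' j)%O && (e (nth x0 s' i) (nth x0 s' j) == (j == i.+1 :> nat)).
  by move=> ltij; apply: ind_path_nth; rewrite // ltij ltn_ord.
exists (fun i => nth x0 s' i) => [i j /hlt /andP[]//|i j].
have [ltij|ltji|/eqP eqij] := ltngtP i j.
- have /andP[_ /eqP->] := hlt _ _ ltij.
  by rewrite [X in _ || X](_ : _ = false) ?orbF //; apply/eqP; lia.
- have /andP[_ /eqP] := hlt _ _ ltji; rewrite sym => ->.
  by rewrite [X in X || _](_ : _ = false) //; apply/eqP; lia.
- by rewrite (eqP eqij) irr; apply/esym/negbTE; lia.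
Qed.

(** At least half of [W] has degree at most [D]. This half is cut into consecutive sets [J0], [J]
    and a rest: expansion from [J0] into [J] supplies the first vertex, and [grow_path] takes its
    blocks from the rest. *)
Lemma sparse_path m : exists K, forall d (T : finOrderType d) (e : rel T) t l
    (W : {set T}),
  simple_graph e -> ~ contains_biclique t (complement e) -> (0 < t <= 2 ^ l)%N ->
  (K * (t * l.+1) <= #|W|)%N ->
  (K * (\sum_(x in W) #|W :&: [set y | e x y]|) <= #|W| ^ 2)%N ->
  has_induced_monotone_path m e.
Proof.
case: m => [|m].
  exists 0%N => d T e *.
  by exists (fun i : 'I_0 => False_rect T (notF (ltn_ord i))) => -[].
pose K1 := (10 * m.+2)%N; exists (2 * K1)%N => d T e t l W gr nb tl cW sW.
pose deg x := #|W :&: [set y | e x y]|.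
pose D := (#|W| %/ K1)%N; pose W' := [set x in W | (deg x <= D)%N].
have sW' : W' \subset W by apply/subsetP=> x; rewrite inE => /andP[].
have W_gt0 : (0 < #|W|)%N.
  apply: leq_trans cW; rewrite !muln_gt0 /=; case/andP: tl => -> _; lia.
have ltD : (#|W| < D.+1 * K1)%N by rewrite ltn_ceil //; lia.
have leD : (D * K1 <= #|W|)%N by apply: leq_trunc_div.
(* Markov's inequality: a vertex outside [W'] has degree at least [D.+1], and [D.+1 * K1] exceeds
   [#|W|]. *)
have cbad : (2 * #|W :\: W'| <= #|W|)%N.
  have h : (#|W :\: W'| * D.+1 <= \sum_(x in W) deg x)%N.
    rewrite [X in (_ <= X)%N](big_setID W') /= -sum_nat_const.
    apply: leq_trans (leq_addl _ _); apply: leq_sum => x.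
    by rewrite !inE negb_and => /andP[/orP[/negP nW /nW//|]]; rewrite ltnNge.
  have {}h : (2 * #|W :\: W'| * (D.+1 * K1) <= #|W| * (D.+1 * K1))%N.
    apply: leq_trans (leq_mul (leqnn _) (ltnW ltD)); rewrite mulnn.
    apply: leq_trans sW; rewrite -/(deg _).
    have -> : (2 * #|W :\: W'| * (D.+1 * K1) = 2 * K1 * (#|W :\: W'| * D.+1))%N by lia.
    by rewrite leq_mul2l h orbT.
  by rewrite leq_pmul2r // in h; lia.
have cW' : (#|W| <= 2 * #|W'|)%N.
  have := cardsID W' W; rewrite (setIidPr sW'); lia.
pose a := (6 * t * l.+1)%N.
have total : (2 * (m.+2 * (a + 2 * D)) <= #|W|)%N.
  (* Here 5 is 3 + 2: [a * K1] is at most [3 * #|W|], and [D * K1] at most [#|W|]. *)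
  rewrite -(@leq_pmul2l 5) //.
  have -> : (5 * (2 * (m.+2 * (a + 2 * D))) = a * K1 + 2 * (D * K1))%N.
    by rewrite /K1; ring.
  have -> : (a * K1 = 3 * (2 * K1 * (t * l.+1)))%N by rewrite /a; ring.
  lia.
have {}total : (a + (a + D) + m * (a + 2 * D) <= #|W'|)%N.
  have -> : (m * (a + 2 * D) = m.+2 * (a + 2 * D) - 2 * (a + 2 * D))%N.
    by rewrite -mulnBl; congr (_ * _)%N; lia.
  have : (2 * (a + 2 * D) <= m.+2 * (a + 2 * D))%N by rewrite leq_mul2r; apply/orP; right.
  lia.
have [|J0 [sJ0 cJ0 ltJ0]] := @split_low _ _ W' a; first lia.
have cZ0 := cardsD W' J0; rewrite (setIidPr sJ0) cJ0 in cZ0.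
have [|J [sJ cJ ltJ]] := @split_low _ _ (W' :\: J0) (a + D); first lia.
have cZ := cardsD (W' :\: J0) J; rewrite (setIidPr sJ) cJ in cZ.
have sJW : J \subset W' by apply: subset_trans sJ (subsetDl _ _).
have ltJ0J : all_lt J0 J by apply: (all_lt_sub (A := J0) (B := W' :\: J0)).
have [|B [sB cB hB]] := expansion (l := l) nb sJ0 sJW ltJ0J; first by rewrite cJ0.
have /card_gt0P[v vB] : (0 < #|B|)%N by case/andP: tl; lia.
have vJ0 := subsetP sB _ vB.
have dW' x : x \in W' -> (#|W' :&: [set y | e x y]| <= D)%N.
  rewrite inE => /andP[_]; apply: leq_trans.
  by apply/subset_leq_card/setSI.
have [| | | | | |s [cs _ ps]] :=
    @grow_path _ _ e t l D m W' J ((W' :\: J0) :\: J) v nb tl sJW _ ltJ dW'.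
- by apply: subset_trans (subsetDl _ _) (subsetDl _ _).
- by apply: dW'; apply: (subsetP sJ0).
- by rewrite cJ.
- lia.
- by apply/negP => vJ; have := ltJ0J v v vJ0 vJ; rewrite ltxx.
- apply: hB; first by rewrite sub1set.
  by rewrite cards1 mul1n; case/andP: tl.
by rewrite -cs -[(size s).+1]/(size (v :: s)); apply: ind_pathW.
Qed.

(** * Greedy embedding *)

Definition edges (T : finType) (r : rel T) (A B : {set T}) : nat :=
  \sum_(u in A) #|[set v in B | r u v]|.

Definition lower_dense (R : realFieldType) (T : finType) (a s s' : R) (r : rel T)
    (A A' : {set T}) : Prop :=
  forall B B' : {set T}, B \subset A -> B' \subset A' -> s <= #|B|%:R ->
    s' <= #|B'|%:R -> a * #|B|%:R * #|B'|%:R <= (edges r B B')%:R.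

(** If the atypical vertices numbered [s], their total of edges to [B'] would violate lower
    density. *)
Lemma few_atypical (R : realFieldType) (T : finType) (a s s' : R) (r : rel T)
    (A A' B B' : {set T}) : lower_dense a s s' r A A' ->
  B \subset A -> B' \subset A' -> 0 < s -> s' <= #|B'|%:R ->
  #|[set u in B | (#|[set v in B' | r u v]|%:R : R) < a * #|B'|%:R]|%:R < s.
Proof.
move=> low sB sB' s_gt0 leB'; rewrite ltNge; apply/negP=> le_s.
set X := [set u in B | _] in le_s.
have sX : X \subset A by apply: subset_trans sB; apply/subsetP=> u; rewrite inE => /andP[].
have := low X B' sX sB' le_s leB'; apply/negP; rewrite -ltNge.
have /card_gt0P[u0 u0X] : (0 < #|X|)%N by rewrite -(ltr0n R) (lt_le_trans s_gt0).
rewrite /edges natr_sum mulrAC mulr_natr -sumr_const.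
apply: ltr_sum => [|u]; first by apply/hasP; exists u0; rewrite ?mem_index_enum.
by rewrite inE => /andP[_].
Qed.

Lemma card_bigcup_le (I T : finType) (P : pred I) (F : I -> {set T}) :
  (#|\bigcup_(i | P i) F i| <= \sum_(i | P i) #|F i|)%N.
Proof.
elim/big_ind2: _ => [|A a B b leA leB|//]; first by rewrite cards0.
by rewrite cardsU (leq_trans (leq_subr _ _)) ?leq_add.
Qed.

(* Each unordered pair {p, par p} is embedded at once, in the order given by rk;
   only mere existence of a compatible pair is assumed between C p and
   C (par p), so the two vertices may not be chosen one after the other. *)
Lemma greedy_embedding (R : realFieldType) (I T : finType)
    (compat : I -> I -> rel T) (par : I -> I) (rk : I -> nat) (al : I -> I -> R)
    (s : I -> R) (C0 : I -> {set T}) (b : R) (t0 : T) :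
  0 < b <= 1 -> (forall p, 0 < s p) -> involutive par ->
  (forall p q u v, compat p q u v = compat q p v u) ->
  (forall p q, p != q -> par p != q -> b <= al p q /\
     lower_dense (al p q) (s p) (s q) (compat p q) (C0 p) (C0 q)) ->
  (forall p q, par p != p -> p != q -> par p != q -> (rk p <= rk q)%N ->
     1 + b <= al p q + al (par p) q) ->
  (forall p (B B' : {set T}), par p != p -> B \subset C0 p ->
     B' \subset C0 (par p) -> s p <= #|B|%:R -> s (par p) <= #|B'|%:R ->
     exists u v, [/\ u \in B, v \in B' & compat p (par p) u v]) ->
  forall n (U : {set I}) (C : I -> {set T}), (#|U| <= n)%N ->
  (forall p, p \in U -> par p \in U) -> (forall p, p \in U -> C p \subset C0 p) ->
  (forall p, p \in U -> #|I|.+1%:R * s p <= b ^+ n * #|C p|%:R) ->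
  exists v : I -> T, (forall p, p \in U -> v p \in C p) /\
    forall p q, p \in U -> q \in U -> p != q -> compat p q (v p) (v q).
Proof.
move=> /andP[b_gt0 b_le1] s_gt0 parK compatC lowH pairH weakH.
elim=> [|n IHn] U C.
  rewrite leqn0 cards_eq0 => /eqP-> _ _ _; exists (fun=> t0).
  by split=> [p|p q]; rewrite inE.
move=> cU parU sC cC.
have [->|/set0Pn[p0 p0U]] := eqVneq U set0.
  by exists (fun=> t0); split=> [p|p q]; rewrite inE.
(* Least rank makes the hypothesis on pairs available against every index still to be embedded. *)
have [p pU minp] : exists2 p, p \in U & forall q, q \in U -> (rk p <= rk q)%N.
  by have [p pU minp] := arg_minnP rk p0U; exists p.
have cC1 q : q \in U -> #|I|.+1%:R * s q <= #|C q|%:R.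
  move=> qU; apply: le_trans (cC q qU) _.
  by rewrite ler_piMl // exprn_ile1 // ltW.
have I_gt0 : (0 < #|I|)%N by apply/card_gt0P; exists p.
have leCs q : q \in U -> s q <= #|C q|%:R.
  move=> /cC1; apply: le_trans; rewrite ler_peMl ?(ltW (s_gt0 _)) //.
  by rewrite ler1n.
pose good q (V : {set I}) := [set u in C q |
  [forall x in V, al q x * #|C x|%:R <= #|[set v in C x | compat q x u v]|%:R]].
(* Each index of [V] spoils at most [s q] of the at least [#|I|.+1 * s q] vertices of [C q]. *)
have goodP q (V : {set I}) : q \in U -> V \subset U -> q \notin V ->
    par q \notin V -> s q <= #|good q V|%:R.
  move=> qU /subsetP VU qV pqV.
  pose bad x := [set u in C q |
    (#|[set v in C x | compat q x u v]|%:R : R) < al q x * #|C x|%:R].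
  have cbad x : x \in V -> #|bad x|%:R <= s q.
    move=> xV; have [|| _ lowx] := lowH q x.
    - by apply: contraNneq qV => ->.
    - by apply: contraNneq pqV => ->.
    have xU := VU x xV.
    apply: ltW; exact: (few_atypical lowx (sC q qU) (sC x xU) (s_gt0 q) (leCs x xU)).
  have sub : C q \subset good q V :|: \bigcup_(x in V) bad x.
    apply/subsetP=> u uC; rewrite in_setU inE uC /=.
    case: (boolP [forall x in V, _]) => //= /forall_inPn[x xV].
    rewrite -ltNge => lt; apply/bigcupP; exists x => //.
    by rewrite inE uC.
  have le1 : (#|C q| <= #|good q V| + \sum_(x in V) #|bad x|)%N.
    apply: leq_trans (subset_leq_card sub) _.
    rewrite cardsU; apply: leq_trans (leq_subr _ _) _; rewrite leq_add2l.
    exact: card_bigcup_le.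
  have le2 : \sum_(x in V) #|bad x|%:R <= #|I|%:R * s q.
    apply: (@le_trans _ _ (\sum_(x in V) s q)); first exact: ler_sum.
    rewrite sumr_const -[s q *+ _]mulr_natl ler_wpM2r ?(ltW (s_gt0 _)) // ler_nat.
    exact: max_card.
  have := cC1 q qU; move: le1; rewrite -(ler_nat R) natrD natr_sum.
  by move: le2; rewrite -natr1; clear; lra.
(* Common end of both cases: indices outside [V] are fixed by [v0], and candidate sets over [V] keep
   a fraction [b], which one factor of [b ^+ n.+1] pays for. *)
have restrict (V : {set I}) (C' : I -> {set T}) (v0 : I -> T) : V \subset U -> p \notin V ->
    (forall x, x \in V -> par x \in V) ->
    (forall x, x \in V -> C' x \subset C x) ->
    (forall x, x \in V -> b * #|C x|%:R <= #|C' x|%:R) ->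
    (forall x, x \in U :\: V -> v0 x \in C x) ->
    (forall x y, x \in U :\: V -> y \in U :\: V -> x != y -> compat x y (v0 x) (v0 y)) ->
    (forall x y u, x \in U :\: V -> y \in V -> u \in C' y -> compat x y (v0 x) u) ->
    exists v : I -> T, (forall p, p \in U -> v p \in C p) /\
      forall p q, p \in U -> q \in U -> p != q -> compat p q (v p) (v q).
  move=> VU pV parV sC' cC' v0C v0c v0V.
  have [||||v [vC vc]] := IHn V C' => //.
  - by rewrite -ltnS; apply: leq_trans cU; apply/proper_card/properP; split=> //; exists p.
  - by move=> x xV; apply: subset_trans (sC' x xV) (sC x (subsetP VU _ xV)).
  - move=> x xV; apply: le_trans (cC x (subsetP VU _ xV)) _.
    by rewrite exprSr -mulrA ler_wpM2l ?exprn_ge0 ?(ltW b_gt0) ?cC'.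
  exists (fun x => if x \in V then v x else v0 x); split=> [x xU|x y xU yU ne].
    case: ifPn => [xV|xV]; last by rewrite v0C ?inE ?xV.
    exact: (subsetP (sC' x xV)) (vC x xV).
  case: ifPn => xV; case: ifPn => yV.
  - exact: vc.
  - by rewrite compatC v0V ?inE ?yV ?yU ?vC.
  - by rewrite v0V ?inE ?xV ?xU ?vC.
  - by rewrite v0c ?inE ?yV ?xV.
have [parp|parp] := eqVneq (par p) p.
  have pUp : p \notin U :\ p by rewrite !inE eqxx.
  have le_s : s p <= #|good p (U :\ p)|%:R.
    by apply: goodP; rewrite ?parp ?pU ?subD1set ?pUp.
  have /card_gt0P[u] : (0 < #|good p (U :\ p)|)%N.
    by rewrite -(ltr0n R) (lt_le_trans (s_gt0 p)).
  rewrite inE => /andP[uC /forall_inP uG].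
  have only x : x \in U :\: (U :\ p) -> x = p.
    by rewrite !inE negb_and negbK => /andP[/orP[/eqP//|/negP nx] /nx].
  apply: (restrict (U :\ p) (fun x => [set v in C x | compat p x u v]) (fun=> u)).
  - exact: subD1set.
  - by [].
  - move=> x; rewrite !inE => /andP[ne xU]; rewrite parU // andbT.
    by apply: contraNneq ne => E; rewrite -(parK x) E parp.
  - by move=> x _; apply/subsetP=> v; rewrite inE => /andP[].
  - move=> x xV; apply: le_trans (uG x xV).
    rewrite ler_wpM2r ?ler0n //; have := xV; rewrite !inE => /andP[ne _].
    by have [|| ] := lowH p x; rewrite ?parp // eq_sym.
  - by move=> x /only->.
  - by move=> x y /only-> /only->; rewrite eqxx.
  - by move=> x y v /only-> _; rewrite inE => /andP[].
set V := U :\: [set p; par p].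
have VU : V \subset U by apply: subsetDl.
have pV : p \notin V by rewrite !inE eqxx.
have qV : par p \notin V by rewrite !inE eqxx orbT.
have qU := parU p pU.
have nV x : x \in V -> [/\ p != x, par p != x & x \in U].
  by rewrite !inE negb_or => /andP[/andP[ne1 ne2] xU]; rewrite eq_sym ne1 eq_sym ne2.
have [u [v [uG vG cuv]]] : exists u v,
    [/\ u \in good p V, v \in good (par p) V & compat p (par p) u v].
  apply: weakH => //.
  - by apply: subset_trans (sC p pU); apply/subsetP=> x; rewrite inE => /andP[].
  - by apply: subset_trans (sC _ qU); apply/subsetP=> x; rewrite inE => /andP[].
  - exact: goodP.
  - by apply: goodP; rewrite ?parK.
move: uG vG; rewrite !inE => /andP[uC /forall_inP uG] /andP[vC /forall_inP vG].
have only x : x \in U :\: V -> x = p \/ x = par p.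
  by rewrite !inE negb_and negbK => /andP[/orP[/orP[]/eqP|/negP nx /nx//]]; [left|right].
apply: (restrict V (fun x => [set w in C x | compat p x u w] :&:
    [set w in C x | compat (par p) x v w]) (fun x => if x == p then u else v)).
- exact: VU.
- exact: pV.
- move=> x xV; have [ne1 ne2 xU] := nV x xV; rewrite !inE negb_or parU // andbT.
  by rewrite (inv_eq parK) (inj_eq (can_inj parK)) ![x == _]eq_sym ne1 ne2.
- by move=> x _; apply/subsetP=> w; rewrite !inE => /andP[/andP[]].
- move=> x xV; have [ne1 ne2 xU] := nV x xV.
  have := pairH p x parp ne1 ne2 (minp x xU).
  have := uG x xV; have := vG x xV.
  set X := [set w in C x | compat p x u w]; set Y := [set w in C x | _].
  (* By inclusion-exclusion, the common candidates are a fraction at least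
     [al p x + al (par p) x - 1 >= b] of [C x]. *)
  have cI : (#|X| + #|Y| <= #|C x| + #|X :&: Y|)%N.
    rewrite -cardsUI leq_add2r; apply/subset_leq_card/subsetP=> w.
    by rewrite !inE -andb_orr => /andP[].
  move: cI; rewrite -(ler_nat R) !natrD => cI leY leX.
  move/(ler_wpM2r (ler0n R #|C x|)); move: cI leX leY; rewrite !mulrDl mul1r; clear; lra.
- by move=> x /only[]->; rewrite ?eqxx // (negPf parp).
- move=> x y /only[]-> /only[]->; rewrite ?eqxx ?(negPf parp) // => _.
  by rewrite compatC.
- by move=> x y w /only[]-> _; rewrite ?eqxx ?(negPf parp) !inE => /andP[/andP[_ ?] /andP[_ ?]].
Qed.

(** * Regular tuples of sets *)

Section Boxes.
Context {I T : finType}.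
Implicit Types (A : I -> {set T}) (W : {set {ffun I -> T}}).

Definition box A : {set {ffun I -> T}} :=
  [set x : {ffun I -> T} | [forall i, x i \in A i]].

Definition upd A p (B : {set T}) : I -> {set T} := fun q => if q == p then B else A q.

Lemma updE A p B : upd A p B p = B. Proof. by rewrite /upd eqxx. Qed.

Lemma upd_neq A p B q : q != p -> upd A p B q = A q.
Proof. by rewrite /upd => /negPf->. Qed.

Lemma in_box_upd A p (B : {set T}) (x : {ffun I -> T}) : B \subset A p ->
  (x \in box (upd A p B)) = (x \in box A) && (x p \in B).
Proof.
move=> /subsetP sB; rewrite !inE; apply/forallP/andP => [xA|[/forallP xA xB] i].
  have xB : x p \in B by have := xA p; rewrite updE.
  split=> //; apply/forallP=> i; have := xA i; rewrite /upd.
  by case: eqP => // -> _; apply: sB.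
by rewrite /upd; case: eqP => // ->.
Qed.

Lemma card_box A : #|box A| = (\prod_i #|A i|)%N.
Proof.
rewrite -sum1_card big_mkcond /=.
transitivity (\sum_(x : {ffun I -> T}) \prod_i nat_of_bool (x i \in A i))%N.
  apply: eq_bigr => x _; rewrite inE; case: ifPn => [/forallP xA|].
    by rewrite big1 // => i _; rewrite xA.
  rewrite negb_forall => /existsP[i xi].
  by rewrite (bigD1 i) //= (negPf xi) mul0n.
rewrite -(bigA_distr_bigA (fun i t => nat_of_bool (t \in A i))).
apply: eq_bigr => i _; rewrite -sum1_card [RHS]big_mkcond /=.
by apply: eq_bigr => t _; case: (t \in A i).
Qed.

Lemma prod_upd A p B : (\prod_i #|upd A p B i| = #|B| * \prod_(i | i != p) #|A i|)%N.
Proof.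
rewrite (bigD1 p) //= updE; congr (_ * _)%N.
by apply: eq_bigr => i ip; rewrite upd_neq.
Qed.

(** Fixing the [i]-th coordinate to [u] leaves a box whose [j]-th side is the neighbourhood of [u]
    in [A j]. The identity is multiplied out to avoid quotients. *)
Lemma card_box_rel (r : rel T) A i j : i != j ->
  (#|[set x in box A | r (x i) (x j)]| * (#|A i| * #|A j|) =
   edges r (A i) (A j) * \prod_k #|A k|)%N.
Proof.
move=> ij; pose Au u := upd (upd A i [set u]) j [set v in A j | r u v].
have -> : #|[set x in box A | r (x i) (x j)]| = (\sum_(u in A i) #|box (Au u)|)%N.
  rewrite -sum1_card (partition_big (fun x : {ffun I -> T} => x i) (mem (A i))) /=; last first.
    by move=> x; rewrite !inE => /andP[/forallP].
  apply: eq_bigr => u uA; rewrite -sum1_card; apply: eq_bigl => x.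
  have ji : j != i by rewrite eq_sym.
  rewrite /Au !in_box_upd ?upd_neq ?sub1set //.
    have -> : (x j \in [set v in A j | r u v]) = (x j \in A j) && r u (x j) by rewrite inE.
    rewrite in_set1 inE; case: (boolP (x \in box A)) => //=.
    rewrite inE => /forallP/(_ j)-> /=.
    by rewrite andbC; case: eqP => // ->.
  by apply/subsetP=> v; rewrite inE => /andP[].
rewrite big_distrl /edges [RHS]big_distrl /=; apply: eq_bigr => u uA.
rewrite card_box prod_upd (bigD1 i) //= updE cards1 mul1n.
rewrite [X in (_ = _ * X)%N](bigD1 i) //= [X in (_ = _ * (_ * X))%N](bigD1 j) 1?eq_sym //=.
rewrite (eq_bigl (fun k => (k != i) && (k != j))) => [|k]; last by rewrite andbC.
rewrite [X in (_ * X * _)%N](eq_bigr (fun k => #|A k|)) => [|k /andP[ki kj]];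
  last by rewrite upd_neq.
by rewrite -!mulnA; congr (_ * _)%N; rewrite mulnC -!mulnA.
Qed.

Lemma card_box_split W A p (B : {set T}) : B \subset A p ->
  #|W :&: box A| = (#|W :&: box (upd A p B)| + #|W :&: box (upd A p (A p :\: B))|)%N.
Proof.
move=> sB; pose D := [set x : {ffun I -> T} | x p \in B].
have inD x : (x \in D) = (x p \in B) by rewrite inE.
rewrite -(cardsID D (W :&: box A)); congr (_ + _)%N; apply: eq_card => x.
  by rewrite !in_setI in_box_upd // inD andbA.
rewrite in_setD !in_setI in_box_upd ?subsetDl // in_setD inD.
case: (x \in W) (boolP (x \in box A)) => [] [|] //=; rewrite ?andbF // inE.
by move=> /forallP/(_ p)->; rewrite andbT.
Qed.

End Boxes.

Section Density.
Context {R : realType} {I T : finType}.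
Implicit Types (A : I -> {set T}) (W : {set {ffun I -> T}}).

Definition dens (r : rel T) (A B : {set T}) : R :=
  (edges r A B)%:R / (#|A|%:R * #|B|%:R).

(** The edge density of the multipartite hypergraph [W] on the parts [A]; it is 0 if a part is
    empty. *)
Definition box_dens W A : R := #|W :&: box A|%:R / (\prod_i #|A i|)%:R.

Lemma edges_le (r : rel T) (A B : {set T}) : (edges r A B <= #|A| * #|B|)%N.
Proof.
rewrite /edges -sum_nat_const; apply: leq_sum => u _.
by apply/subset_leq_card/subsetP=> v; rewrite inE => /andP[].
Qed.

Lemma ratio_bound (a b : nat) : (a <= b)%N -> 0 <= (a%:R / b%:R : R) <= 1.
Proof.
move=> ab; apply/andP; split; first by apply: divr_ge0.
case: b ab => [|b] ab; first by rewrite invr0 mulr0.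
by rewrite ler_pdivrMr ?ltr0n // mul1r ler_nat.
Qed.

Lemma dens_bound r (A B : {set T}) : 0 <= dens r A B <= 1.
Proof. by rewrite /dens -natrM; apply: ratio_bound; apply: edges_le. Qed.

Lemma box_dens_bound W A : 0 <= box_dens W A <= 1.
Proof.
apply: ratio_bound; rewrite -card_box.
by apply/subset_leq_card/subsetIr.
Qed.

Lemma box_dens_le W A (r : rel T) i j : i != j -> (forall i, 0 < #|A i|)%N ->
  (forall x, x \in W -> r (x i) (x j)) -> box_dens W A <= dens r (A i) (A j).
Proof.
move=> ij A_gt0 Wr.
have prod_gt0 : (0 < \prod_k #|A k|)%N by apply: prodn_gt0.
rewrite /box_dens /dens ler_pdivrMr ?ltr0n // mulrAC ler_pdivlMr; last first.
  by rewrite mulr_gt0 ?ltr0n.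
rewrite -!natrM -card_box_rel // ler_nat leq_mul2r; apply/orP; right.
by apply/subset_leq_card/subsetP=> x; rewrite !inE => /andP[/Wr-> ->].
Qed.

Lemma box_dens_split W A p (B : {set T}) : B \subset A p ->
  #|A p|%:R * box_dens W A = #|B|%:R * box_dens W (upd A p B) +
    #|A p :\: B|%:R * box_dens W (upd A p (A p :\: B)).
Proof.
move=> sB.
have unnorm (C : {set T}) : C \subset A p -> #|C|%:R * box_dens W (upd A p C) =
    #|W :&: box (upd A p C)|%:R / (\prod_(i | i != p) #|A i|)%:R.
  move=> sC; rewrite /box_dens prod_upd natrM invfM mulrCA.
  have [C0|C0] := eqVneq (#|C|%:R : R) 0; last by rewrite mulVKf.
  suff -> : W :&: box (upd A p C) = set0 by rewrite cards0 !mul0r.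
  apply/setP=> x; rewrite in_setI in_box_upd //.
  move/eqP: C0; rewrite pnatr_eq0 cards_eq0 => /eqP->.
  by rewrite !in_set0 !andbF.
have updid : upd A p (A p) = A by apply/funext => i; rewrite /upd; case: eqP => [->|].
have := unnorm _ (subxx (A p)); rewrite updid => ->.
by rewrite !unnorm ?subsetDl // -mulrDl -natrD -card_box_split.
Qed.

Lemma mul_dens_l r (A B : {set T}) : #|A|%:R * dens r A B = (edges r A B)%:R / #|B|%:R.
Proof.
rewrite /dens invfM mulrCA; have [A0|A0] := eqVneq (#|A|%:R : R) 0.
  have := edges_le r A B; move/eqP: A0; rewrite pnatr_eq0 => /eqP->.
  by rewrite mul0n leqn0 => /eqP->; rewrite !mul0r.
by rewrite mulVKf.
Qed.

Lemma mul_dens_r r (A B : {set T}) : #|B|%:R * dens r A B = (edges r A B)%:R / #|A|%:R.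
Proof.
rewrite /dens invfM mulrCA [_^-1 * _^-1]mulrC; have [B0|B0] := eqVneq (#|B|%:R : R) 0.
  have := edges_le r A B; move/eqP: B0; rewrite pnatr_eq0 => /eqP->.
  by rewrite muln0 leqn0 => /eqP->; rewrite !mul0r.
by rewrite mulVKf.
Qed.

Lemma dens_split_l r (A A1 B : {set T}) : A1 \subset A ->
  #|A|%:R * dens r A B = #|A1|%:R * dens r A1 B + #|A :\: A1|%:R * dens r (A :\: A1) B.
Proof.
move=> sA; rewrite !mul_dens_l -mulrDl -natrD; congr (_%:R / _).
by rewrite /edges (big_setID A1) (setIidPr sA).
Qed.

Lemma dens_split_r r (A B B1 : {set T}) : B1 \subset B ->
  #|B|%:R * dens r A B = #|B1|%:R * dens r A B1 + #|B :\: B1|%:R * dens r A (B :\: B1).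
Proof.
move=> sB; rewrite !mul_dens_r -mulrDl -natrD; congr (_%:R / _).
rewrite /edges -big_split /=; apply: eq_bigr => u _.
rewrite -(cardsID B1 [set v in B | r u v]); congr (_ + _)%N; apply: eq_card => v.
  by rewrite !inE; case: (boolP (v \in B1)) => [/(subsetP sB)->|_]; rewrite ?andbT ?andbF.
by rewrite !inE andbA.
Qed.

Lemma card_split (A B : {set T}) : B \subset A ->
  #|A|%:R = #|B|%:R + #|A :\: B|%:R :> R.
Proof. by move=> sB; rewrite -(cardsID B A) (setIidPr sB) natrD. Qed.

Lemma dens_upd_split r A p (B : {set T}) i j : i != j -> B \subset A p ->
  #|A p|%:R * dens r (A i) (A j) = #|B|%:R * dens r (upd A p B i) (upd A p B j) +
  #|A p :\: B|%:R * dens r (upd A p (A p :\: B) i) (upd A p (A p :\: B) j).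
Proof.
move=> ij sB; have [pi|pi] := eqVneq i p.
  by rewrite -pi !updE !upd_neq 1?eq_sym //; apply: dens_split_l; rewrite pi.
have [pj|pj] := eqVneq j p.
  by rewrite -pj !updE !upd_neq //; apply: dens_split_r; rewrite pj.
by rewrite !upd_neq // -mulrDl -card_split.
Qed.

End Density.

Section Potential.
Context {R : realType} {K I T : finType} (E : K -> rel T) (W : {set {ffun I -> T}}).
Context (lam : R) (lam_gt0 : 0 < lam).
Implicit Types (A : I -> {set T}).

Definition pair_dens (z : K * (I * I)) A : R := dens (E z.1) (A z.2.1) (A z.2.2).

Definition potential A : R :=
  box_dens W A + lam * \sum_(z : K * (I * I) | z.2.1 != z.2.2) pair_dens z A ^+ 2.

Lemma potential_bound A : 0 <= potential A <= 1 + lam * #|{: K * (I * I)}|%:R.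
Proof.
have /andP[w0 w1] := box_dens_bound (R := R) W A.
have d2 z : 0 <= pair_dens z A ^+ 2 <= 1.
  have /andP[d0 d1] := dens_bound (R := R) (E z.1) (A z.2.1) (A z.2.2).
  by rewrite sqr_ge0 exprn_ile1.
have s0 : 0 <= \sum_(z : K * (I * I) | z.2.1 != z.2.2) pair_dens z A ^+ 2.
  by apply: sumr_ge0 => z _; have /andP[] := d2 z.
rewrite /potential addr_ge0 ?(mulr_ge0 (ltW lam_gt0)) //= lerD // ler_pM2l //.
apply: (@le_trans _ _ (\sum_(z : K * (I * I) | z.2.1 != z.2.2) 1)).
  by apply: ler_sum => z _; have /andP[] := d2 z.
by rewrite sumr_const ler_nat max_card.
Qed.

(** Defect Cauchy-Schwarz: the density of [W] averages exactly, and each squared density gains the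
    variance of its two values, of which one term for [z] is kept. *)
Lemma potential_split A p (B : {set T}) z : B \subset A p -> z.2.1 != z.2.2 ->
  #|A p|%:R * potential A +
    lam * (#|B|%:R * (pair_dens z (upd A p B) - pair_dens z A) ^+ 2) <=
  #|B|%:R * potential (upd A p B) +
    #|A p :\: B|%:R * potential (upd A p (A p :\: B)).
Proof.
move=> sB nz; set A1 := upd A p B; set A2 := upd A p _.
set b := #|B|%:R; set b2 := #|_ :\: _|%:R.
have -> : b * potential A1 + b2 * potential A2 =
    #|A p|%:R * box_dens W A + lam * \sum_(z : K * (I * I) | z.2.1 != z.2.2)
      (b * pair_dens z A1 ^+ 2 + b2 * pair_dens z A2 ^+ 2).
  rewrite (box_dens_split _ sB) /potential big_split /= -!mulr_sumr; ring.
rewrite /potential mulrDr -addrA lerD2l [_ * (lam * _)]mulrCA -mulrDr ler_pM2l //.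
have termP x : x.2.1 != x.2.2 -> #|A p|%:R * pair_dens x A ^+ 2 +
    b * (pair_dens x A1 - pair_dens x A) ^+ 2 <=
    b * pair_dens x A1 ^+ 2 + b2 * pair_dens x A2 ^+ 2.
  move=> nx; have := dens_upd_split (R := R) (E x.1) nx sB; rewrite -!/(pair_dens x _).
  have := card_split (R := R) sB; rewrite -/b -/b2 -/A1 -/A2.
  move: (pair_dens x A) (pair_dens x A1) (pair_dens x A2) => d0 d1 d2 -> eqd.
  rewrite -subr_ge0.
  have -> : b * d1 ^+ 2 + b2 * d2 ^+ 2 - ((b + b2) * d0 ^+ 2 + b * (d1 - d0) ^+ 2) =
      b2 * (d2 - d0) ^+ 2 + 2 * d0 * (b * d1 + b2 * d2 - (b + b2) * d0) by ring.
  by rewrite eqd subrr mulr0 addr0 mulr_ge0 ?sqr_ge0 ?ler0n.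
rewrite (bigD1 z) //= [leRHS](bigD1 z) //= mulrDr addrAC lerD ?termP //.
rewrite mulr_sumr; apply: ler_sum => x /andP[nx _]; apply: le_trans (termP x nx).
by rewrite lerDl mulr_ge0 ?sqr_ge0 ?ler0n.
Qed.

Definition locally_max (th : R) A : Prop := forall A', (forall i, A' i \subset A i) ->
  (forall i, th * #|A i|%:R <= #|A' i|%:R) -> potential A' <= potential A + th.

(** Each failure of local maximality gains more than [th] in potential and costs a factor [th] in
    the sides; boundedness allows at most [m] failures. *)
Lemma exists_locally_max (th : R) A m : 0 < th <= 1 ->
  1 + lam * #|{: K * (I * I)}|%:R - potential A <= m%:R * th ->
  exists A', [/\ forall i, A' i \subset A i,
    forall i, th ^+ m * #|A i|%:R <= #|A' i|%:R,
    potential A <= potential A' & locally_max th A'].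
Proof.
move=> /andP[th0 th1]; elim: m A => [|m IHm] A leA.
  exists A; split=> // [i|A' _ _]; first by rewrite expr0 mul1r.
  have /andP[_] := potential_bound A'; move: leA th0; rewrite mul0r; clear; lra.
have [max|/existsNP[A1 /not_implyP[s1 /not_implyP[c1 /negP]]]] :=
    pselect (locally_max th A).
  exists A; split=> // i.
  by rewrite ler_piMl // exprn_ile1 // ltW.
rewrite -ltNge => lt1.
have [|A' [sA' cA' pA' max]] := IHm A1.
  by move: leA lt1; rewrite -natr1; clear; nra.
exists A'; split=> // [i|i|].
- exact: subset_trans (sA' i) (s1 i).
- apply: le_trans (cA' i).
  by rewrite exprSr -mulrA ler_wpM2l ?exprn_ge0 ?(ltW th0).
- by apply: le_trans pA'; apply: le_trans (ltW lt1); rewrite lerDl ltW.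
Qed.
End Potential.

(** [M] bounds the potential of sub-boxes that are not too small. A remainder of weight below
    [th * w] escapes this bound, but with potential at most 2 it adds at most [2 * th]. The second
    conclusion keeps [P1] near [M], so that the piece can be split again. *)
Lemma increment_bound (R : realFieldType) (w b b2 eps th lam D M P0 P1 P2 : R) :
  0 < w -> w = b + b2 -> 0 <= b -> 0 <= b2 -> eps * w <= b -> 0 <= D -> 0 < lam -> 0 <= M ->
  0 <= th -> w * P0 + lam * (b * D) <= b * P1 + b2 * P2 -> P1 <= M -> P2 <= 2 ->
  (th * w <= b2 -> P2 <= M) ->
  lam * eps * D <= M - P0 + 2 * th /\ eps * (M - P1) <= M - P0 + 2 * th.
Proof.
move=> w0 we b0 b20 leb D0 lam0 M0 th0 main P1M P22 P2M.
have leP2 : b2 * P2 <= b2 * M + 2 * th * w.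
  have [le|lt] := leP (th * w) b2.
    by have := P2M le; nra.
  by nra.
have h1 : eps * w * (lam * D) <= b * (lam * D) by rewrite ler_wpM2r // mulr_ge0 ?(ltW lam0).
have h2 : eps * w * (M - P1) <= b * (M - P1) by rewrite ler_wpM2r // subr_ge0.
have h3 : 0 <= b * (M - P1) by apply: mulr_ge0; rewrite ?subr_ge0.
have h4 : 0 <= lam * (b * D) by rewrite !mulr_ge0 // ltW.
by split; rewrite -(ler_pM2l w0); move: h4 main leP2 h1 h2 h3; rewrite we; clear; lra.
Qed.

Lemma sqr_le_half (R : realFieldType) (x e : R) : 0 < e -> x ^+ 2 <= e ^+ 2 / 4 ->
  `|x| <= e / 2.
Proof.
move=> e0 le; rewrite -(@ler_pXn2r _ 2) ?nnegrE ?normr_ge0 ?divr_ge0 ?(ltW e0) //.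
by rewrite real_normK ?num_real // exprMn exprVn -natrX.
Qed.

(** The sides are replaced one at a time, [A i] by [B] and then [A j] by [B']. Each replacement
    moves the density by at most [eps / 2], or its variance term would contradict local
    maximality. *)
Lemma locally_max_regular (R : realType) (K I T : finType) (E : K -> rel T)
    (W : {set {ffun I -> T}}) (lam eps th : R) (A : I -> {set T}) :
  0 < lam -> lam * #|{: K * (I * I)}|%:R <= 1 -> 0 < eps <= 1 ->
  0 < th <= eps -> 20 * th <= lam * eps ^+ 4 -> (forall i, 0 < #|A i|)%N ->
  locally_max E W lam th A ->
  forall k i j (B B' : {set T}), i != j -> B \subset A i -> B' \subset A j ->
    eps * #|A i|%:R <= #|B|%:R -> eps * #|A j|%:R <= #|B'|%:R ->
    `|dens (E k) B B' - dens (E k) (A i) (A j)| <= eps :> R.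
Proof.
move=> lam0 lam1 /andP[eps0 eps1] /andP[th0 theps] th20 A_gt0 maxA k i j B B' ij sB sB' cB cB'.
have th1 : th <= 1 by apply: le_trans eps1.
have ji : j != i by rewrite eq_sym.
have P2 A' : potential E W lam A' <= 2.
  have /andP[_] := potential_bound E W lam0 A'; move: lam1; clear; lra.
have M0 : 0 <= potential E W lam A + th.
  by rewrite addr_ge0 ?(ltW th0) //; have /andP[] := potential_bound E W lam0 A.
pose z := (k, (i, j)).
have A0 p : 0 < #|A p|%:R :> R by rewrite ltr0n.
have thA p : th * #|A p|%:R <= #|A p|%:R by rewrite ler_piMl.
have thB : th * #|A i|%:R <= #|B|%:R by apply: le_trans cB; rewrite ler_wpM2r.
have thB' : th * #|A j|%:R <= #|B'|%:R by apply: le_trans cB'; rewrite ler_wpM2r.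
set A1 := upd A i B.
have sA1 p : A1 p \subset A p by rewrite /A1 /upd; case: eqP => [->|].
have cA1 p : th * #|A p|%:R <= #|A1 p|%:R by rewrite /A1 /upd; case: eqP => [->|].
have A1j : A1 j = A j by rewrite /A1 upd_neq.
have [] := increment_bound (eps := eps) (th := th) (A0 i) (card_split sB) (ler0n _ _) (ler0n _ _) cB
  (sqr_ge0 _) lam0 M0 (ltW th0) (potential_split E W lam0 (z := z) sB ij).
- exact: maxA.
- exact: P2.
- move=> c; apply: maxA => p; rewrite /upd; case: eqP => [->|_] //.
  exact: subsetDl.
rewrite -/A1 => D1 PA1.
have sB1 : B' \subset A1 j by rewrite A1j.
have cB1 : eps * #|A1 j|%:R <= #|B'|%:R by rewrite A1j.
have [] := increment_bound (eps := eps) (th := th) _ (card_split sB1) (ler0n _ _) (ler0n _ _) cB1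
  (sqr_ge0 _) lam0 M0 (ltW th0) (potential_split E W lam0 (z := z) sB1 ij).
- by rewrite A1j.
- apply: maxA => p; rewrite /upd; case: eqP => [->|]; rewrite ?A1j //.
- exact: P2.
- move=> c; apply: maxA => p; rewrite /upd; case: eqP => [->|] //; rewrite -?A1j //.
  by apply: subset_trans (subsetDl _ _) _; rewrite A1j.
move=> D2 _.
have E1 : pair_dens E z A1 = dens (E k) B (A j) by rewrite /pair_dens /= /A1 updE upd_neq.
have E2 : pair_dens E z (upd A1 j B') = dens (E k) B B'.
  by rewrite /pair_dens /= updE upd_neq // /A1 updE.
have E0 : pair_dens E z A = dens (E k) (A i) (A j) by [].
move: D1 D2; rewrite E1 E2 E0.
set d0 := dens _ (A i) _; set d1 := dens _ B (A j); set d2 := dens _ B B' => D1 D2.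
have le1 : `|d1 - d0| <= eps / 2.
  apply: sqr_le_half => //.
  rewrite -(ler_pM2l (mulr_gt0 lam0 eps0)); apply: le_trans D1 _.
  have : eps ^+ 4 <= eps ^+ 3 by rewrite ler_wiXn2l ?(ltW eps0).
  by move: th20 lam0; clear; rewrite !exprS; nra.
have le2 : `|d2 - d1| <= eps / 2.
  apply: sqr_le_half => //.
  (* The second split starts within [3 * th / eps] of the bound, so after multiplication by [eps]
     its error is [3 * th + 2 * eps * th <= 5 * th]; hence the 20 in the hypothesis. *)
  rewrite -(ler_pM2l (mulr_gt0 lam0 eps0)) -(ler_pM2l eps0).
  apply: le_trans (_ : 5 * th <= _); last first.
    by move: th20; clear; rewrite !exprS; lra.
  apply: le_trans (ler_wpM2l (ltW eps0) D2) _.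
  by move: PA1 eps1 th0 eps0; clear; nra.
have -> : d2 - d0 = (d2 - d1) + (d1 - d0) by ring.
apply: le_trans (ler_normD _ _) _; move: le1 le2; clear; lra.
Qed.

(* The potential box_dens W + lam * (sum of squared densities) of a box is bounded,
   and an irregular pair yields a smaller box, of comparable size, on which it
   increases by a fixed amount; W keeps half of its density. *)
Theorem regular_boxes (R : realType) (K I : finType) (kap eps : R) :
  0 < kap -> 0 < eps <= 1 -> exists2 rho : R, 0 < rho <= 1 &
  forall (T : finType) (E : K -> rel T) (W : {set {ffun I -> T}}) (A : I -> {set T}),
    (forall i, 0 < #|A i|)%N -> kap <= box_dens W A ->
  exists A' : I -> {set T},
  [/\ forall i, A' i \subset A i, forall i, rho * #|A i|%:R <= #|A' i|%:R,
      kap / 2 <= box_dens W A' &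
      forall k i j (B B' : {set T}), i != j -> B \subset A' i -> B' \subset A' j ->
        eps * #|A' i|%:R <= #|B|%:R -> eps * #|A' j|%:R <= #|B'|%:R ->
        `|dens (E k) B B' - dens (E k) (A' i) (A' j)| <= eps :> R].
Proof.
move=> kap0 /andP[eps0 eps1].
pose n : R := #|{: K * (I * I)}|%:R.
have n0 : 0 <= n by apply: ler0n.
(* The squared densities contribute at most [kap / 2] to the potential, so potential [kap] leaves
   [box_dens] at least [kap / 2]. *)
pose lam : R := Num.min 1 kap / (2 * (n + 1)).
have mk0 : 0 < Num.min 1 kap by rewrite lt_min ltr01.
have lam0 : 0 < lam by rewrite divr_gt0 // mulr_gt0 ?ltr0n // ltr_wpDl.
have lamn : lam * n <= Num.min 1 kap / 2.
  rewrite /lam -mulrA ler_pM2l // invfM -mulrA ler_piMr ?invr_ge0 //.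
  by rewrite mulrC ler_pdivrMr ?mul1r ?lerDl // ltr_wpDl.
have /andP[lamn1 lamnk] : (lam * n <= 1) && (lam * n <= kap / 2).
  have le1 : Num.min 1 kap <= 1 by rewrite ge_min lexx.
  have lek : Num.min 1 kap <= kap by rewrite ge_min lexx orbT.
  by move: lamn le1 lek; clear; lra.
pose th : R := Num.min eps (lam * eps ^+ 4 / 20).
have th0 : 0 < th by rewrite lt_min eps0 divr_gt0 // mulr_gt0 ?exprn_gt0.
have the : th <= eps by rewrite ge_min lexx.
have th20 : 20 * th <= lam * eps ^+ 4.
  rewrite mulrC -ler_pdivlMr //; by rewrite ge_min lexx orbT.
pose m := Num.bound (2 / th).
have mth : 2 <= m%:R * th.
  by rewrite -ler_pdivrMr // ltW // archi_boundP // divr_ge0 // ltW.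
exists (th ^+ m) => [|T E W A A_gt0 kapW].
  by rewrite exprn_gt0 //= exprn_ile1 ?(ltW th0) // (le_trans the).
have [||A' [sA' cA' pA' maxA']] := @exists_locally_max R K I T E W lam lam0 th A m.
- by rewrite th0 (le_trans the).
- apply: le_trans mth; have /andP[+ _] := potential_bound E W lam0 A.
  by move: lamn1; rewrite -/n; clear; lra.
have A'_gt0 i : (0 < #|A' i|)%N.
  by rewrite -(ltr0n R) (lt_le_trans _ (cA' i)) // mulr_gt0 ?exprn_gt0 ?ltr0n.
exists A'; split=> //; last first.
  have eps01 : 0 < eps <= 1 by rewrite eps0.
  have th0e : 0 < th <= eps by rewrite th0.
  exact: (locally_max_regular lam0 lamn1 eps01 th0e th20 A'_gt0 maxA').
have le1 : \sum_(z : K * (I * I) | z.2.1 != z.2.2) pair_dens E z A' ^+ 2 <= n :> R.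
  apply: (@le_trans _ _ (\sum_(z : K * (I * I) | z.2.1 != z.2.2) 1)).
    apply: ler_sum => z _; rewrite exprn_ile1 //;
    by have /andP[] := dens_bound (R := R) (E z.1) (A' z.2.1) (A' z.2.2).
  by rewrite sumr_const ler_nat max_card.
have le2 : box_dens W A <= potential E W lam A.
  by rewrite lerDl mulr_ge0 ?(ltW lam0) ?sumr_ge0 // => z _; rewrite sqr_ge0.
have le3 : potential E W lam A' <= box_dens W A' + lam * n.
  by rewrite lerD2l ler_pM2l.
by move: kapW le2 pA' le3 lamnk; clear; lra.
Qed.

(** * Ordered regular tuples *)

(** The rank counts the vertices from which [x] is reachable. Along an edge to [y], the vertex [y]
    itself is new, as a path from [y] back to [x] would close a cycle. *)
Lemma acyclic_rank (T : finType) (D : rel T) : acyclic D ->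
  exists rk : T -> nat, forall x y, D x y -> (rk x < rk y)%N.
Proof.
move=> acD; exists (fun x => #|[set z | connect D z x]|) => x y Dxy.
apply: proper_card; apply/properP; split.
  by apply/subsetP=> z; rewrite !inE => zx; apply: connect_trans (connect1 Dxy).
exists y; rewrite !inE ?connect0 //; apply/negP => /connectP[p pp xE].
move: Dxy; rewrite xE; case/shortenP: pp => p' pp' up' _ Dly.
by apply: (acD (y :: p')) => //; rewrite /ucycle /cycle rcons_path pp' Dly.
Qed.

(* The order is regularized together with e: since W consists of increasing tuples,
   some u in the top quarter of A1 i lies below some v in the bottom quarter of
   A1 j, so the middle halves are comparable. *)
Theorem ordered_regular_boxes (R : realType) (N : nat) (kap eps : R) :
  0 < kap -> 0 < eps <= 1 -> exists2 rho : R, 0 < rho <= 1 &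
  forall d (T : finOrderType d) (e : rel T) (W : {set {ffun 'I_N -> T}})
      (A : 'I_N -> {set T}),
    (forall x (i j : 'I_N), x \in W -> (i < j)%N -> (x i < x j)%O) ->
    (forall i, 1 <= rho * #|A i|%:R) -> kap <= box_dens W A ->
  exists A1 A2 : 'I_N -> {set T},
  [/\ forall i, A2 i \subset A1 i /\ A1 i \subset A i,
      forall i, rho * #|A i|%:R <= #|A2 i|%:R,
      kap / 2 <= box_dens W A1,
      forall i j : 'I_N, (i < j)%N -> all_lt (A2 i) (A2 j) &
      forall i j (B B' : {set T}), i != j -> B \subset A2 i -> B' \subset A2 j ->
        eps * #|A2 i|%:R <= #|B|%:R -> eps * #|A2 j|%:R <= #|B'|%:R ->
        `|dens e B B' - dens e (A1 i) (A1 j)| <= eps :> R].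
Proof.
move=> kap0 /andP[eps0 eps1].
(* In turn: quarters of a part count as large, density [kap / 2] cannot drop to 0, and a fraction
   [eps] of a middle half is large in the part. *)
pose eps' := Num.min (1 / 8) (Num.min (kap / 4) (eps / 2)).
have e'0 : 0 < eps' by rewrite !lt_min !divr_gt0.
have e'8 : eps' <= 1 / 8 by rewrite ge_min lexx.
have e'k : eps' <= kap / 4 by rewrite !ge_min lexx orbT.
have e'e : eps' <= eps / 2 by rewrite !ge_min lexx !orbT.
have [|rho0 /andP[rho0_gt0 rho0_le1] H] := @regular_boxes R bool 'I_N kap eps' kap0.
  by rewrite e'0; move: e'8; clear; lra.
(* The 16 gives parts of at least 16 vertices, so that a quarter rounded down is at least an
   eighth. *)
exists (rho0 / 16) => [|d T e W A Winc A_big kapW].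
  by move: rho0_gt0 rho0_le1; clear; lra.
have A_gt0 i : (0 < #|A i|)%N.
  rewrite lt0n; apply/eqP=> A0; have := A_big i; rewrite A0 mulr0; clear; lra.
pose E b : rel T := if b then e else fun x y => (x < y)%O.
have {H}[A1 [sA1 cA1 dW reg]] := H T E W A A_gt0 kapW.
have A1_big i : (16 <= #|A1 i|)%N.
  rewrite -(ler_nat R); apply: le_trans (cA1 i).
  by move: (A_big i); clear; lra.
have /fin_all_exists[f fP] i : exists LMH : {set T} * {set T} * {set T},
    let: (L, M, H) := LMH in
    [/\ all_lt L M, all_lt M H & [/\ L \subset A1 i, M \subset A1 i & H \subset A1 i]] /\
    [/\ eps' * #|A1 i|%:R <= #|L|%:R, eps' * #|A1 i|%:R <= #|H|%:R &
        #|A1 i|%:R / 2 <= #|M|%:R :> R].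
  set n := #|A1 i|; pose a := (n %/ 4)%N.
  have n16 : (16 <= n)%N := A1_big i.
  have [|L [sL cL ltL]] := @split_low _ _ (A1 i) a; first exact: leq_div.
  have cA1L : #|A1 i :\: L| = (n - a)%N by rewrite cardsD (setIidPr sL) cL.
  have [|M [sM cM ltM]] := @split_low _ _ (A1 i :\: L) (n - 2 * a).
    by rewrite cA1L leq_sub2l // leq_pmull.
  have cH : #|(A1 i :\: L) :\: M| = a.
    rewrite cardsD (setIidPr sM) cM cA1L /a; move: n16; clear; lia.
  have na8 : n%:R / 8 <= a%:R :> R.
    by rewrite ler_pdivrMr // -natrM ler_nat /a; move: n16; clear; lia.
  have na2 : n%:R / 2 <= (n - 2 * a)%:R :> R.
    by rewrite ler_pdivrMr // -natrM ler_nat /a; clear; lia.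
  have ea : eps' * n%:R <= a%:R.
    apply: le_trans na8; rewrite mulrC ler_wpM2l //; move: e'8; clear; lra.
  exists (L, M, (A1 i :\: L) :\: M); split; last by rewrite cL cM cH.
  split=> //.
    by move=> x y xL /(subsetP sM); apply: ltL.
  split=> //; first exact: subset_trans sM (subsetDl _ _).
  exact: subset_trans (subsetDl _ _) (subsetDl _ _).
pose M i := (f i).1.2; exists A1, M; split.
- move=> i; split=> //; rewrite /M; have := fP i; case: (f i) => [[L M'] H] /=.
  by move=> [[_ _ []]].
- move=> i; rewrite /M; have := fP i; case: (f i) => [[L M'] H] /=.
  move=> [_ [_ _]]; apply: le_trans; have := cA1 i; have : 0 <= #|A i|%:R :> R by [].
  by move: rho0_gt0; clear; nra.
- exact: dW.
- move=> i j ltij x y; rewrite /M; have := fP i; have := fP j.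
  case: (f i) => [[L M'] H] /=; case: (f j) => [[L2 M2] H2] /=.
  move=> [[ltLM2 _ [sL2 _ _]] [cL2 _ _]] [[_ ltMH [_ _ sH]] [_ cH _]] xM yM.
  have ij : i != j by apply: contraTneq ltij => ->; rewrite ltnn.
  have A1_gt0 k : (0 < #|A1 k|)%N by apply: leq_trans (A1_big k).
  have d1 := box_dens_le (R := R) (r := E false) ij A1_gt0 (fun x xW => Winc x i j xW ltij).
  have := reg false i j H L2 ij sH sL2 cH cL2.
  case: (boolP [exists u in H, exists v in L2, (u < v)%O]) => [|none].
    case/exists_inP=> u uH /exists_inP[v vL uv] _.
    exact: lt_trans (lt_trans (ltMH x u xM uH) uv) (ltLM2 v y vL yM).
  have -> : dens (E false) H L2 = 0 :> R.
    rewrite /dens [edges _ _ _]big1 ?mul0r // => u uH; apply/eqP; rewrite cards_eq0.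
    apply/eqP/setP=> v; rewrite !inE; apply/negP => /andP[vL uv].
    by case/exists_inP: none; exists u => //; apply/exists_inP; exists v.
  rewrite sub0r normrN ger0_norm; last by have /andP[] := dens_bound (R := R) (E false) (A1 i) (A1 j).
  by move=> le; exfalso; move: le dW d1 e'k kap0; clear; lra.
- move=> i j B B' ij; rewrite /M; have := fP i; have := fP j.
  case: (f i) => [[L M'] H] /=; case: (f j) => [[L2 M2] H2] /=.
  move=> [[_ _ [_ sM2 _]] [_ _ cM2]] [[_ _ [_ sM _]] [_ _ cM]] sB sB' cB cB'.
  have large (n m b : R) : n / 2 <= m -> eps * m <= b -> 0 <= n -> eps' * n <= b.
    by move: e'e eps0; clear; nra.
  have le1 := reg true i j B B' ij (subset_trans sB sM) (subset_trans sB' sM2)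
    (large _ _ _ cM cB (ler0n _ _)) (large _ _ _ cM2 cB' (ler0n _ _)).
  by apply: le_trans le1 _; move: e'e eps0; clear; lra.
Qed.

Lemma edges_sum (T : finType) (r : rel T) (A B : {set T}) :
  edges r A B = (\sum_(u in A) \sum_(v in B) r u v)%N.
Proof.
apply: eq_bigr => u _; rewrite -sum1_card big_mkcond [RHS]big_mkcond /=.
by apply: eq_bigr => v _; rewrite inE; case: (v \in B) (r u v) => [] [].
Qed.

Lemma edges_sym (T : finType) (r : rel T) (A B : {set T}) :
  symmetric r -> edges r A B = edges r B A.
Proof.
move=> sym; rewrite !edges_sum exchange_big /=.
by apply: eq_bigr => u _; apply: eq_bigr => v _; rewrite sym.
Qed.

Lemma edges_increasing d (T : finOrderType d) (e : rel T) (A : {set T}) :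
  simple_graph e ->
  edges e A A = (2 * edges (fun x y => e x y && (x < y)%O) A A)%N.
Proof.
move=> [sym irr]; pose r x y := e x y && (x < y)%O; rewrite -/r mul2n -addnn.
have E : edges r A A = edges (fun x y => r y x) A A by rewrite !edges_sum exchange_big.
rewrite {2}E !edges_sum -big_split; apply: eq_bigr => u _; rewrite -big_split.
apply: eq_bigr => v _; rewrite /r [e v u]sym /=.
by case: (ltgtP u v) => [||->]; rewrite ?andbT ?andbF ?irr ?addn0.
Qed.

(* By sparse_path every linear-sized set has positive edge density. *)
Lemma inner_pair (R : realType) (m : nat) : exists2 kap : R, 0 < kap &
  forall eps : R, 0 < eps <= 1 -> exists2 rho : R, 0 < rho <= 1 & exists2 K : R, 0 < K &
  forall d (T : finOrderType d) (e : rel T) t l (A : {set T}),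
    simple_graph e -> ~ contains_biclique t (complement e) ->
    ~ has_induced_monotone_path m e -> (0 < t <= 2 ^ l)%N ->
    K * (t * l.+1)%:R <= #|A|%:R ->
  exists X Y : {set T}, [/\ X \subset A, Y \subset A, all_lt X Y,
    rho * #|A|%:R <= #|X|%:R /\ rho * #|A|%:R <= #|Y|%:R &
    forall B B' : {set T}, B \subset X -> B' \subset Y ->
      eps * #|X|%:R <= #|B|%:R -> eps * #|Y|%:R <= #|B'|%:R -> kap <= dens e B B'].
Proof.
have [K0 sparse] := sparse_path m.
(* As [sparse_path] must fail on [A], more than a fraction [1 / K0.+1] of the ordered pairs are
   edges, half of them increasing. *)
pose kap2 : R := 1 / (2 * K0.+1%:R).
have kap2_gt0 : 0 < kap2 by rewrite divr_gt0 // mulr_gt0 ?ltr0n.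
exists (kap2 / 4); first by rewrite divr_gt0.
move=> eps /andP[eps0 eps1].
pose eps' := Num.min eps (kap2 / 4).
have e'0 : 0 < eps' <= 1 by rewrite lt_min eps0 divr_gt0 //= ge_min eps1.
have e'e : eps' <= eps by rewrite ge_min lexx.
have e'k : eps' <= kap2 / 4 by rewrite ge_min lexx orbT.
have [rho /andP[rho0 rho1] H] := @ordered_regular_boxes R 2 kap2 eps' kap2_gt0 e'0.
exists rho; first by rewrite rho0.
have rK0 : 0 < 1 / rho :> R by rewrite divr_gt0.
exists (K0.+1%:R + 1 / rho) => [|d T e t l A gr nb np tl cA].
  by rewrite addr_gt0 ?ltr0n.
have tl1 : 1 <= (t * l.+1)%:R :> R by rewrite ler1n muln_gt0 andbT; case/andP: tl.
have cA1 : K0.+1%:R * (t * l.+1)%:R <= #|A|%:R :> R.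
  by apply: le_trans cA; rewrite ler_wpM2r // lerDl ltW.
have cA2 : 1 <= rho * #|A|%:R.
  rewrite mulrC -ler_pdivrMr //; apply: le_trans cA.
  apply: (@le_trans _ _ ((K0.+1%:R + 1 / rho) * 1)); last by rewrite ler_pM2l ?addr_gt0 ?ltr0n.
  by rewrite mulr1 lerDr.
have A_gt0 : (0 < #|A|)%N.
  by rewrite lt0n; apply/eqP=> A0; move: cA2; rewrite A0 mulr0; clear; lra.
have {sparse}dense : (#|A| ^ 2 < K0.+1 * edges e A A)%N.
  rewrite ltnNge; apply/negP=> le; apply: np; apply: (sparse _ T e t l A gr nb tl).
    move: cA1; rewrite -natrM ler_nat; apply: leq_trans; rewrite leq_mul2r leqnSn orbT //.
  apply: leq_trans le; apply: leq_mul => //; apply: leq_sum => x _.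
  by apply/subset_leq_card/subsetP=> y; rewrite !inE.
pose r x y := e x y && (x < y)%O.
(* Regularizing the increasing edges, as tuples of length 2, yields the two ordered sets. *)
pose W := [set x : {ffun 'I_2 -> T} | r (x ord0) (x ord_max)].
have kapW : kap2 <= box_dens W (fun=> A).
  have := card_box_rel r (fun=> A) (isT : (ord0 : 'I_2) != ord_max).
  rewrite prod_nat_const card_ord -mulnn => /eqP.
  rewrite eqn_pmul2r ?muln_gt0 ?A_gt0 // => /eqP cW.
  rewrite /box_dens; have -> : W :&: box (fun=> A) = [set x in box (fun=> A) | r (x ord0) (x ord_max)].
    by apply/setP=> x; rewrite !inE andbC.
  rewrite cW prod_nat_const card_ord ler_pdivlMr ?ltr0n ?expn_gt0 ?A_gt0 //.
  rewrite /kap2 mulrAC mul1r ler_pdivrMr ?mulr_gt0 ?ltr0n // -!natrM ler_nat.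
  move: dense; rewrite edges_increasing // => /ltnW; rewrite -/r; clear; lia.
have [x i j||A1 [A2 [sA cA2' kapA1 ltA reg]]] := H d T e W (fun=> A) _ _ kapW.
- move=> xW ltij; move: xW; rewrite inE => /andP[_].
  have lti := ltn_ord i; have ltj := ltn_ord j.
  have i0 : (i : nat) = 0%N by move: (nat_of_ord i) (nat_of_ord j) lti ltj ltij; clear; lia.
  have j1 : (j : nat) = 1%N by move: (nat_of_ord i) (nat_of_ord j) lti ltj ltij; clear; lia.
  have -> : i = ord0 by apply: ord_inj.
  by have -> : j = ord_max by apply: ord_inj.
- by [].
exists (A2 ord0), (A2 ord_max); split.
- by have [s1 s2] := sA ord0; apply: subset_trans s2.
- by have [s1 s2] := sA ord_max; apply: subset_trans s2.
- exact: ltA.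
- by split; apply: cA2'.
move=> B B' sB sB' cB cB'.
have A1_gt0 i : (0 < #|A1 i|)%N.
  have [/subset_leq_card s1 _] := sA i; apply: leq_trans s1.
  by rewrite -(ltr0n R); apply: lt_le_trans (cA2' i); apply: lt_le_trans cA2.
have d1 := box_dens_le (R := R) (r := e) (isT : (ord0 : 'I_2) != ord_max) A1_gt0.
have {}d1 := d1 W _; have /d1 {}d1 x : x \in W -> e (x ord0) (x ord_max).
  by rewrite inE => /andP[].
have := reg ord0 ord_max B B' isT sB sB' (le_trans (ler_wpM2r (ler0n _ _) e'e) cB)
  (le_trans (ler_wpM2r (ler0n _ _) e'e) cB').
rewrite ler_distl => /andP[lo _]; move: lo kapA1 d1 e'k; clear; lra.
Qed.

(** * Increasing independent tuples and densities of complements *)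

Lemma ffact_ge n r : (2 * r <= n)%N -> (n ^ r <= 2 ^ r * n ^_ r)%N.
Proof.
elim: r => [|r IHr] le; first by rewrite !expn0 ffactn0.
rewrite !expnS ffactnSr.
have -> : (2 * 2 ^ r * (n ^_ r * (n - r)) = (2 * (n - r)) * (2 ^ r * n ^_ r))%N by ring.
by apply: leq_mul; [lia | apply: IHr; lia].
Qed.

Definition independent_tuples d (T : finOrderType d) (e : rel T) (r : nat) :
    {set {ffun 'I_r -> T}} :=
  [set x : {ffun 'I_r -> T} | [forall i : 'I_r, forall j : 'I_r,
    (i < j)%N ==> (x i < x j)%O && ~~ e (x i) (x j)]].

(** Listing a clique of the complement in increasing order gives a tuple, and [ffact_ge] turns the
    binomial coefficient into a power. *)
Lemma independent_tuples_dense (R : realType) r d (T : finOrderType d) (e : rel T)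
    (eps : R) : 0 <= eps -> (2 * r <= #|T|)%N ->
  eps < clique_density R r (complement e) ->
  eps / (2 ^ r * r`!)%:R <= box_dens (independent_tuples e r) (fun=> [set: T]).
Proof.
move=> eps0 ler; rewrite /clique_density.
set S := [set A : {set T} | _].
have bin_gt0 : (0 < 'C(#|T|, r))%N by rewrite bin_gt0; apply: leq_trans ler; rewrite leq_pmull.
rewrite ltr_pdivlMr ?ltr0n // => ltS.
have leS : (#|S| <= #|independent_tuples e r|)%N.
  apply: leq_trans (leq_imset_card (fun x : {ffun 'I_r -> T} => [set x i | i in 'I_r]) _).
  apply/subset_leq_card/subsetP=> A; rewrite inE => /andP[/eqP cA /forall_inP clA].
  pose v (i : 'I_r) := Order.enum_val (cast_ord (esym cA) i).
  have vA i : v i \in A by apply: Order.enum_valP.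
  have v_inj : injective v by move=> i j /Order.enum_val_inj/cast_ord_inj.
  apply/imsetP; exists [ffun i => v i].
    rewrite inE; apply/forallP=> i; apply/forallP=> j; apply/implyP=> ltij; rewrite !ffunE.
    have ne : v i != v j by rewrite (inj_eq v_inj); apply: contraTneq ltij => ->; rewrite ltnn.
    rewrite lt_neqAle ne Order.le_enum_val; last exact: le_total.
    rewrite leEord /= ltnW //=.
    by have := forall_inP (clA (v i) (vA i)) (v j) (vA j); rewrite /complement ne.
  apply/eqP; rewrite eq_sym eqEcard; apply/andP; split.
    by apply/subsetP=> x /imsetP[i _ ->]; rewrite ffunE.
  rewrite cA card_imset ?card_ord // => i j; rewrite !ffunE; apply: v_inj.
rewrite /box_dens.
have -> : independent_tuples e r :&: box (fun=> [set: T]) = independent_tuples e r.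
  by apply/setIidPl/subsetP=> x _; rewrite inE; apply/forallP.
rewrite prod_nat_const card_ord cardsT.
have T_gt0 : (0 < #|T| ^ r)%N by rewrite expn_gt0; case: (r) ler => [|r'] le; rewrite ?orbT //; apply/orP; left; lia.
rewrite ler_pdivlMr ?ltr0n // mulrAC ler_pdivrMr ?ltr0n ?muln_gt0 ?expn_gt0 ?fact_gt0 //.
apply: (@le_trans _ _ (eps * ((2 ^ r * r`!)%:R * 'C(#|T|, r)%:R))).
  rewrite ler_wpM2l // -natrM ler_nat -mulnA [(r`! * _)%N]mulnC bin_ffact.
  exact: ffact_ge.
rewrite mulrCA [leRHS]mulrC ler_pM2l ?ltr0n ?muln_gt0 ?expn_gt0 ?fact_gt0 //.
by apply: le_trans (ltW ltS) _; rewrite ler_nat.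
Qed.

Lemma edges_negb (T : finType) (r : rel T) (A B : {set T}) :
  (edges r A B + edges (fun x y => ~~ r x y) A B = #|A| * #|B|)%N.
Proof.
rewrite /edges -big_split -sum_nat_const; apply: eq_bigr => u _ /=.
rewrite -(cardsID [set v | r u v] B); congr (_ + _)%N; apply: eq_card => v;
by rewrite !inE // andbC.
Qed.

Lemma dens_negb (R : realType) (T : finType) (r : rel T) (A B : {set T}) :
  (0 < #|A|)%N -> (0 < #|B|)%N -> dens (fun x y => ~~ r x y) A B = 1 - dens r A B :> R.
Proof.
move=> A0 B0; apply/eqP; rewrite eq_sym subr_eq eq_sym -mulrDl -natrD addnC edges_negb.
by rewrite natrM divff // mulf_neq0 // pnatr_eq0 -lt0n.
Qed.

Lemma dens_sym (R : realType) (T : finType) (r : rel T) (A B : {set T}) :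
  symmetric r -> dens r A B = dens r B A :> R.
Proof. by move=> sym; rewrite /dens edges_sym // [X in _ / X]mulrC. Qed.

Lemma densM (R : realType) (T : finType) (r : rel T) (A B : {set T}) :
  dens r A B * #|A|%:R * #|B|%:R = (edges r A B)%:R :> R.
Proof.
have := edges_le r A B; have := mul_dens_l (R := R) r A B.
rewrite [X in X = _]mulrC => ->.
case: (posnP #|B|) => [->|B0 _]; first by rewrite muln0 leqn0 => /eqP->; rewrite !mul0r.
by rewrite divfK // pnatr_eq0 -lt0n.
Qed.

(** * Embedding along an admissible coloring *)

(* A pair of parts is red if it is sparse. The path has its vertices 2i and 2i+1 in
   the i-th part, and par exchanges 2i+1 and 2i+2 if the parts i and i+1 form a red
   pair; an edge between two sparse parts can only be picked at once. A vertex
   picked later in a part that is blue to both could be left without candidates,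
   and the rank obtained from the dependency digraph rules this out. *)
Theorem monotone_path_or_biclique (R : realType) (k r : nat) (eps : R) :
  forces_admissible k r -> 0 < eps -> exists2 K : R, 0 < K &
  forall d (T : finOrderType d) (e : rel T) t l,
    simple_graph e -> ~ has_induced_monotone_path (2 * k) e ->
    eps < clique_density R r (complement e) -> (0 < t <= 2 ^ l)%N ->
    K * (t * l.+1)%:R <= #|T|%:R -> contains_biclique t (complement e).
Proof.
move=> forces eps0.
have den_gt0 : 0 < (2 ^ r * r`!)%:R :> R by rewrite ltr0n muln_gt0 expn_gt0 fact_gt0.
pose kap : R := eps / (2 ^ r * r`!)%:R.
have kap0 : 0 < kap by apply: divr_gt0.
have [ki ki0 inner] := inner_pair R (2 * k).
(* Red means density at most [del / 2]. The bounds leave room after two red constraints and give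
   density [2 * del] to non-edges of blue pairs and to edges inside a part. *)
pose del : R := Num.min (1 / 4) (Num.min (kap / 8) (ki / 2)).
have del0 : 0 < del by rewrite !lt_min !divr_gt0.
have del4 : del <= 1 / 4 by rewrite ge_min lexx.
have delk : del <= kap / 8 by rewrite !ge_min lexx orbT.
have deli : del <= ki / 2 by rewrite !ge_min lexx !orbT.
pose bet : R := del / 4.
have bet0 : 0 < bet by rewrite divr_gt0.
have bet1 : bet <= 1 by move: del4; rewrite /bet; clear; lra.
(* The size hypothesis of [greedy_embedding] for [2 * k] indices, solved for the threshold. *)
have [sig sigE] : exists s : R, s = bet ^+ (2 * k) / (2 * k).+1%:R by eexists.
have sig0 : 0 < sig by rewrite sigE divr_gt0 ?exprn_gt0.
have sig1 : sig <= 1.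
  rewrite sigE ler_pdivrMr ?ltr0n // mul1r (@le_trans _ _ 1) ?exprn_ile1 ?(ltW bet0) //.
  by rewrite ler1n.
have [|rho2 /andP[rho20 rho21] [K2 K20 {}inner]] := inner sig; first by rewrite sig0.
have sr0 : 0 < sig * rho2 by rewrite mulr_gt0.
(* A fraction [sig] of a candidate set is a fraction [sig * rho2] of its part, so regularity applies
   to it. *)
pose ep1 : R := Num.min (sig * rho2) (del / 4).
have ep10 : 0 < ep1 by rewrite lt_min sr0 divr_gt0.
have ep1s : ep1 <= sig * rho2 by rewrite ge_min lexx.
have ep1d : ep1 <= del / 4 by rewrite ge_min lexx orbT.
have [|rho1 /andP[rho10 rho11] regular] := @ordered_regular_boxes R r kap ep1 kap0.
  by rewrite ep10; move: ep1d del4; clear; lra.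
have srr0 : 0 < sig * rho2 * rho1 by rewrite mulr_gt0.
(* The summands serve in order the count of tuples, nonempty parts, the size needed by [inner_pair],
   and [t] vertices in every candidate set above its threshold. *)
pose K : R := (2 * r)%:R + 1 / rho1 + K2 / rho1 + 1 / (sig * rho2 * rho1).
have posK : [/\ 0 <= (2 * r)%:R :> R, 0 < 1 / rho1, 0 < K2 / rho1 & 0 < 1 / (sig * rho2 * rho1)].
  by split; rewrite ?ler0n ?divr_gt0.
exists K => [|d T e t l gr np dense tl cT].
  by case: posK; rewrite /K; clear; lra.
apply: contrapT => nb; have [sym irr] := gr.
have tl1 : 1 <= (t * l.+1)%:R :> R by rewrite ler1n muln_gt0 andbT; case/andP: tl.
have tlt : t%:R <= (t * l.+1)%:R :> R by rewrite ler_nat leq_pmulr.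
have leT (c x : R) : 0 <= c -> c <= K -> x <= (t * l.+1)%:R -> c * x <= #|T|%:R.
  move=> c0 cK xt; apply: le_trans cT; apply: le_trans (ler_wpM2l c0 xt) _.
  by rewrite ler_wpM2r.
have rT : (2 * r <= #|T|)%N.
  rewrite -(ler_nat R) -[leLHS]mulr1; apply: leT => //.
  by case: posK; rewrite /K; clear; lra.
have rho1T : 1 <= rho1 * #|T|%:R.
  rewrite mulrC -ler_pdivrMr // -[leLHS]mulr1; apply: leT => //; first exact/ltW/divr_gt0.
  by case: posK; rewrite /K; clear; lra.
have K2T : K2 * (t * l.+1)%:R <= rho1 * #|T|%:R.
  rewrite [leRHS]mulrC -ler_pdivrMr // mulrAC; apply: leT => //; first exact/ltW/divr_gt0.
  by case: posK; rewrite /K; clear; lra.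
have tT : t%:R <= sig * rho2 * rho1 * #|T|%:R.
  rewrite [leRHS]mulrC -ler_pdivrMr // -[t%:R]mul1r mulrAC; apply: leT => //.
    exact/ltW/divr_gt0.
  by case: posK; rewrite /K; clear; lra.
pose W := independent_tuples e r.
have WP x (i j : 'I_r) : x \in W -> (i < j)%N -> (x i < x j)%O && ~~ e (x i) (x j).
  by rewrite inE => /forallP/(_ i)/forallP/(_ j)/implyP.
have [x i j xW ltij||A1 [A2 [sA cA dA ltA reg]]] :=
    regular _ T e W (fun=> [set: T]) _ _ (independent_tuples_dense (ltW eps0) rT dense).
- by have /andP[] := WP x i j xW ltij.
- by move=> _; rewrite cardsT.
have {}cA i : rho1 * #|T|%:R <= #|A2 i|%:R by have := cA i; rewrite cardsT.
have A1_gt0 i : (0 < #|A1 i|)%N.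
  have [/subset_leq_card s1 _] := sA i; apply: leq_trans s1.
  by rewrite -(ltr0n R); apply: lt_le_trans (cA i); apply: lt_le_trans rho1T.
pose dd i j : R := dens e (A1 i) (A1 j).
have ddC i j : dd i j = dd j i by apply: dens_sym.
have dd1 i j : i != j -> dd i j <= 1 - kap / 2.
  move=> ij; have := box_dens_le (R := R) (W := W) (r := fun x y => ~~ e x y) ij A1_gt0.
  rewrite dens_negb // -/(dd i j) => le.
  suff /le : forall x, x \in W -> ~~ e (x i) (x j) by move: dA; clear; lra.
  move=> x xW; have [ltij|ltji|/ord_inj eqij] := ltngtP i j.
  - by have /andP[] := WP x i j xW ltij.
  - by rewrite sym; have /andP[] := WP x j i xW ltji.
  - by rewrite eqij eqxx in ij.
pose chi : coloring r := fun S =>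
  [exists a, exists b, [&& a != b, S == [set a; b] & dd a b <= del / 2]].
have chiE a b : a != b -> chi [set a; b] = (dd a b <= del / 2).
  move=> ab; apply/existsP/idP => [[a' /existsP[b' /and3P[ab' /eqP E]]]|le].
    have : a \in [set a'; b'] by rewrite -E set21.
    have : b \in [set a'; b'] by rewrite -E set22.
    rewrite !inE => /orP[]/eqP bE /orP[]/eqP aE; move: ab; rewrite aE bE ?eqxx // => _.
    by rewrite ddC.
  by exists a; apply/existsP; exists b; rewrite ab eqxx.
have [v vinc adm] := forces chi.
have v_inj : injective v.
  move=> i j eqv; apply/ord_inj; case: (ltngtP i j) => // /vinc; rewrite eqv ltxx.
    by [].
  by [].
pose red i j := dd (v i) (v j) <= del / 2.
have redC i j : red i j = red j i by rewrite /red ddC.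
have colE i j : i != j -> induced_coloring v chi [set i; j] = red i j.
  by move=> ij; rewrite /induced_coloring imsetU1 imset_set1 chiE // (inj_eq v_inj).
have [rk rkP] := acyclic_rank adm.
have blueP (i i' j : 'I_k) : i' = i.+1 :> nat -> j != i -> j != i' -> red i i' ->
    ~~ red i j -> ~~ red i' j -> (rk j < rk i)%N && (rk j < rk i')%N.
  move=> ii' ji ji' rii' bij bi'j.
  have ne : i != i' by rewrite -val_eqE /= ii' ltn_eqF.
  have D y : y \in [:: i; i'] -> dependency_digraph (induced_coloring v chi) j y.
    rewrite !inE => yii'; apply/existsP; exists i; apply/existsP; exists i'.
    by rewrite ii' eqxx ji ji' !colE // 1?eq_sym // rii' (negPf bij) (negPf bi'j) yii'.
  by rewrite !rkP // D // !inE eqxx ?orbT.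
have /fin_all_exists[f fP] (i : 'I_k) : exists XY : {set T} * {set T},
    [/\ XY.1 \subset A2 (v i), XY.2 \subset A2 (v i), all_lt XY.1 XY.2,
    rho2 * #|A2 (v i)|%:R <= #|XY.1|%:R /\ rho2 * #|A2 (v i)|%:R <= #|XY.2|%:R &
    forall B B' : {set T}, B \subset XY.1 -> B' \subset XY.2 ->
      sig * #|XY.1|%:R <= #|B|%:R -> sig * #|XY.2|%:R <= #|B'|%:R -> ki <= dens e B B'].
  have [|X [Y XY]] := inner _ T e t l (A2 (v i)) gr nb np tl; last by exists (X, Y).
  exact: le_trans K2T (cA _).
have half_lt (p : 'I_(2 * k)) : (p./2 < k)%N.
  by have := ltn_ord p; move: (nat_of_ord p); clear; lia.
pose grp p : 'I_k := Ordinal (half_lt p).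
pose C (p : 'I_(2 * k)) := if odd p then (f (grp p)).2 else (f (grp p)).1.
have sC p : C p \subset A2 (v (grp p)) by rewrite /C; case: ifP; have [] := fP (grp p).
have cC p : rho2 * #|A2 (v (grp p))|%:R <= #|C p|%:R.
  by rewrite /C; case: ifP; have [_ _ _ []] := fP (grp p).
have cCt p : t%:R <= sig * #|C p|%:R.
  apply: le_trans tT _; rewrite -!mulrA ler_pM2l //; apply: le_trans (cC p).
  by rewrite ler_pM2l.
have t_gt0 : 0 < t%:R :> R by rewrite ltr0n; case/andP: tl.
have sC0 p : 0 < sig * #|C p|%:R by apply: lt_le_trans (cCt p).
have C_lt (p q : 'I_(2 * k)) : (p < q)%N -> all_lt (C p) (C q).
  move=> ltpq; case: (eqVneq (grp p) (grp q)) => [E|ne].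
    have [op oq] : ~~ odd p /\ odd q.
      move/(congr1 val): E => /= E; move: (nat_of_ord p) (nat_of_ord q) ltpq E; clear; lia.
    by rewrite /C E (negPf op) oq; have [] := fP (grp q).
  apply: all_lt_sub (sC p) (sC q); apply: ltA.
  have : (grp p < grp q)%N.
    by rewrite ltn_neqAle val_eqE ne /= half_leq // ltnW.
  by move/vinc.
pose adj (p q : 'I_(2 * k)) := (q == p.+1 :> nat) || (p == q.+1 :> nat).
have adjC p q : adj p q = adj q p by rewrite /adj orbC.
pose compat p q : rel T := fun x y => e x y == adj p q.
pose pr p q := [&& adj p q, grp p != grp q & red (grp p) (grp q)].
have prC p q : pr p q = pr q p by rewrite /pr adjC eq_sym redC.
have pr_uniq p q q' : pr p q -> pr p q' -> q = q'.
  move=> /and3P[a1 n1 _] /and3P[a2 n2 _]; apply/ord_inj.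
  move: a1 n1 a2 n2; rewrite -!val_eqE /adj /=.
  by move: (nat_of_ord p) (nat_of_ord q) (nat_of_ord q'); clear; lia.
pose par p := odflt p [pick q | pr p q].
have parE p q : pr p q -> par p = q.
  rewrite /par; case: pickP => [q' pq' pq|none pq]; last by rewrite none in pq.
  exact: pr_uniq pq' pq.
have parP p : par p != p -> pr p (par p).
  by rewrite /par; case: pickP => //= _; rewrite eqxx.
have parK : involutive par.
  move=> p; case: (eqVneq (par p) p) => [E|/parP pp]; first by rewrite !E.
  have pp' : pr (par p) p by rewrite (prC (par p) p).
  exact: parE pp'.
(* Edges inside a part have density at least [ki]. Across parts, edges of a blue pair have more than
   [del / 2 - ep1], non-edges of a red pair at least [1 - del / 2 - ep1], and non-edges of a blue
   pair at least [kap / 2 - ep1]. *)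
pose al p q : R := if grp p == grp q then 2 * del else
  if adj p q then bet else if red (grp p) (grp q) then 1 - del else 2 * del.
have crossP p q (B B' : {set T}) : grp p != grp q -> B \subset C p -> B' \subset C q ->
    sig * #|C p|%:R <= #|B|%:R -> sig * #|C q|%:R <= #|B'|%:R ->
    `|dens e B B' - dd (v (grp p)) (v (grp q))| <= ep1.
  move=> ne sB sB' cB cB'.
  have big x (D : {set T}) : sig * #|C x|%:R <= #|D|%:R ->
      ep1 * #|A2 (v (grp x))|%:R <= #|D|%:R.
    apply: le_trans; apply: le_trans (ler_wpM2r (ler0n _ _) ep1s) _.
    by rewrite -mulrA ler_pM2l.
  apply: reg; rewrite ?(inj_eq v_inj) ?big //.
  - exact: subset_trans sB (sC p).
  - exact: subset_trans sB' (sC q).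
have low_of (a : R) (rl : rel T) (B B' : {set T}) : a <= dens rl B B' ->
    a * #|B|%:R * #|B'|%:R <= (edges rl B B')%:R.
  by move=> le; rewrite -densM !ler_wpM2r.
have compat_adj p q B B' : adj p q -> edges (compat p q) B B' = edges e B B'.
  move=> a; apply: eq_bigr => x _; apply: eq_card => y.
  by rewrite !inE /compat a eqb_id.
have compat_nadj p q B B' : adj p q = false ->
    edges (compat p q) B B' = edges (fun x y => ~~ e x y) B B'.
  move=> a; apply: eq_bigr => x _; apply: eq_card => y.
  by rewrite !inE /compat a eqbF_neg.
have lowH p q : p != q -> par p != q -> bet <= al p q /\
    lower_dense (al p q) (sig * #|C p|%:R) (sig * #|C q|%:R) (compat p q) (C p) (C q).
  move=> pq parpq; split.
    by rewrite /al; do 3?case: ifP => _; move: del0 del4; rewrite /bet; clear; lra.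
  move=> B B' sB sB' cB cB'; rewrite /al.
  have [E|ne] := eqVneq (grp p) (grp q).
    have [apq oq] : adj p q /\ odd q = ~~ odd p.
      move/(congr1 val): E; move: pq; rewrite -val_eqE /adj /=.
      by move: (nat_of_ord p) (nat_of_ord q); clear; lia.
    rewrite (compat_adj _ _ _ _ apq); apply: low_of.
    apply: (@le_trans _ _ ki); first by move: deli; clear; lra.
    have [_ _ _ _ dXY] := fP (grp q).
    move: sB sB' cB cB'; rewrite /C E oq; case: (odd p) => /= sB sB' cB cB'.
      by rewrite dens_sym //; apply: dXY.
    exact: dXY.
  have := crossP p q B B' ne sB sB' cB cB'; rewrite ler_distl => /andP[lo up].
  have [apq|nadj] := boolP (adj p q).
    rewrite (compat_adj _ _ _ _ apq); apply: low_of.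
    have nred : ~~ red (grp p) (grp q).
      by apply: contraNN parpq => rpq; apply/eqP/parE; rewrite /pr apq ne rpq.
    by move: nred lo ep1d; rewrite /red -ltNge /bet; clear; lra.
  rewrite (compat_nadj _ _ _ _ (negbTE nadj)); apply: low_of.
  rewrite dens_negb -?(ltr0n R) ?(lt_le_trans (sC0 _) cB) ?(lt_le_trans (sC0 _) cB') //.
  have vne : v (grp p) != v (grp q) by rewrite (inj_eq v_inj).
  have := dd1 _ _ vne; case: (boolP (red _ _)); rewrite /red ?ltNge; move: up ep1d delk del0.
    by clear; lra.
  by clear; lra.
have pairH p q : par p != p -> p != q -> par p != q -> (rk (grp p) <= rk (grp q))%N ->
    1 + bet <= al p q + al (par p) q.
  move=> /parP; move: (par p) => p' /and3P[app' npp' rpp'] pq p'q rkpq.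
  have sum1 : 1 + bet <= 2 * del + (1 - del) by rewrite /bet; move: del0; clear; lra.
  (* [p] and [p'] are [2i+1] and [2i+2] in some order; their other neighbours [2i] and [2i+3] lie in
     the same two parts. *)
  have nadj : adj p q = false /\ adj p' q = false \/ grp p = grp q /\ adj p' q = false \/
      grp p' = grp q /\ adj p q = false.
    have [E|n1] := eqVneq (grp p) (grp q).
      right; left; split=> //; move/(congr1 val): E; move: app' npp' pq p'q.
      rewrite -!val_eqE /adj /=.
      by move: (nat_of_ord p) (nat_of_ord p') (nat_of_ord q); clear; lia.
    have [E|n2] := eqVneq (grp p') (grp q).
      right; right; split=> //; move/(congr1 val): E; move: app' npp' pq p'q.
      rewrite -!val_eqE /adj /=.
      by move: (nat_of_ord p) (nat_of_ord p') (nat_of_ord q); clear; lia.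
    left; move: app' npp' n1 n2; rewrite -!val_eqE /adj /=.
    by move: (nat_of_ord p) (nat_of_ord p') (nat_of_ord q); clear; lia.
  rewrite /al; have [E|n1] := eqVneq (grp p) (grp q).
    have -> : adj p' q = false.
      by case: nadj => [[]|[[]|[E' _]]] //; rewrite E E' eqxx in npp'.
    by rewrite -E eq_sym (negPf npp') redC rpp'.
  have [E|n2] := eqVneq (grp p') (grp q).
    have -> : adj p q = false.
      by case: nadj => [[]|[[E' _]|[]]] //; rewrite E E' eqxx in npp'.
    by rewrite -E rpp' [leRHS]addrC.
  have [-> ->] : adj p q = false /\ adj p' q = false.
    by case: nadj => [|[[E]|[E]]] //; [rewrite E eqxx in n1 | rewrite E eqxx in n2].
  (* One red pair suffices. If both are blue, [blueP] ranks the part of [q] strictly first, against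
     [rkpq]. *)
  case: (boolP (red (grp p) (grp q))) => r1; case: (boolP (red (grp p') (grp q))) => r2.
  - by move: del4 del0; rewrite /bet; clear; lra.
  - by move: sum1; clear; lra.
  - exact: sum1.
  have q1 : grp q != grp p by rewrite eq_sym.
  have q2 : grp q != grp p' by rewrite eq_sym.
  have [E|E] : grp p' = (grp p).+1 :> nat \/ grp p = (grp p').+1 :> nat.
    move: app' npp'; rewrite -!val_eqE /adj /=.
    by move: (nat_of_ord p) (nat_of_ord p'); clear; lia.
  - have /andP[lt _] := blueP _ _ (grp q) E q1 q2 rpp' r1 r2.
    by rewrite leqNgt lt in rkpq.
  - have rp'p : red (grp p') (grp p) by rewrite redC.
    have /andP[_ lt] := blueP _ _ (grp q) E q2 q1 rp'p r2 r1.
    by rewrite leqNgt lt in rkpq.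
have weakH p (B B' : {set T}) : par p != p -> B \subset C p -> B' \subset C (par p) ->
    sig * #|C p|%:R <= #|B|%:R -> sig * #|C (par p)|%:R <= #|B'|%:R ->
    exists x y, [/\ x \in B, y \in B' & compat p (par p) x y].
  move=> ne sB sB' cB cB'; have /and3P[app' _ _] := parP p ne.
  have tB : (t <= #|B|)%N by rewrite -(ler_nat R); apply: le_trans (cCt p) cB.
  have tB' : (t <= #|B'|)%N by rewrite -(ler_nat R); apply: le_trans (cCt _) cB'.
  have [ltpp'|ltp'p|/ord_inj E] := ltngtP p (par p); last by rewrite -E eqxx in ne.
    have [|x [y [xB yB exy]]] := edge_between nb tB tB'.
      exact: all_lt_sub (C_lt _ _ ltpp') sB sB'.
    by exists x, y; rewrite /compat exy app'.
  have [|x [y [xB yB exy]]] := edge_between nb tB' tB.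
    exact: all_lt_sub (C_lt _ _ ltp'p) sB' sB.
  by exists y, x; rewrite /compat sym exy app'.
have [t0] : exists t0 : T, True.
  have /card_gt0P[t0 _] : (0 < #|T|)%N.
    by rewrite lt0n; apply/eqP=> T0; move: rho1T; rewrite T0 mulr0; clear; lra.
  by exists t0.
move=> _.
have [|||||||||||w [wC wE]] := @greedy_embedding R 'I_(2 * k) T compat par
    (fun p => rk (grp p)) al (fun p => sig * #|C p|%:R) C bet t0 _ _ _ _ _ _ _
    (2 * k)%N [set: 'I_(2 * k)] C.
- by rewrite bet0.
- exact: sC0.
- exact: parK.
- by move=> p q x y; rewrite /compat sym adjC.
- exact: lowH.
- exact: pairH.
- exact: weakH.
- by rewrite cardsT card_ord.
- by [].
- by [].
- move=> p _; rewrite card_ord mulrA ler_wpM2r // sigE mulrCA divff ?mulr1 //.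
  by rewrite pnatr_eq0.
apply: np; exists w => [p q ltpq|p q].
  by apply: (C_lt p q ltpq); apply: wC.
have [->|ne] := eqVneq p q.
  rewrite irr; move: (nat_of_ord q); clear; lia.
have := wE p q; rewrite !inE => /(_ isT isT ne) /eqP->; by [].
Qed.

(** * Small values of f *)

Lemma rank_acyclic (T : eqType) (D : rel T) (rk : T -> nat) :
  (forall x y, D x y -> (rk x < rk y)%N) -> acyclic D.
Proof.
move=> rkD [//|x s] _ /andP[/= cyc _].
have lt_path : path (relpre rk ltn) x (rcons s x) by apply: sub_path cyc; exact: rkD.
have /allP/(_ x) := order_path_min (fun y x z => @ltn_trans (rk y) (rk x) (rk z)) lt_path.
by rewrite mem_rcons inE eqxx /= ltnn => /(_ isT).
Qed.

(* Colorings are encoded as the lists of the colors of the pairs i < j, and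
   admissibility is certified by a rank, so that exhaustive search computes. *)
Definition pairs (N : nat) : seq (nat * nat) :=
  [seq (i, j) | i <- iota 0 N, j <- iota i.+1 (N - i.+1)].

Definition color (N : nat) (l : seq bool) (i j : nat) : bool :=
  nth false l (index (if (i < j)%N then (i, j) else (j, i)) (pairs N)).

Definition ranked (k : nat) (c : nat -> nat -> bool) (s rk : seq nat) : bool :=
  all (fun i => all (fun x =>
    if [&& x != i, x != i.+1, c (nth 0 s i)%N (nth 0 s i.+1)%N,
           ~~ c (nth 0 s i)%N (nth 0 s x)%N & ~~ c (nth 0 s i.+1)%N (nth 0 s x)%N]
    then (nth 0 rk x < nth 0 rk i)%N && (nth 0 rk x < nth 0 rk i.+1)%N
    else true) (iota 0 k)) (iota 0 k.-1).

Definition find_ranked (k N : nat) (subs rks : seq (seq nat)) (l : seq bool) : bool :=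
  has (fun s => has (ranked k (color N l) s) rks) subs.

(** The predicate is passed down the recursion, so evaluation builds no list of all [2 ^ n]
    colorings. *)
Fixpoint all_bits (n : nat) (P : pred (seq bool)) : bool :=
  if n is n'.+1 then
    all_bits n' (fun l => P (true :: l)) && all_bits n' (fun l => P (false :: l))
  else P [::].

Lemma all_bitsP n P : all_bits n P -> forall l, size l = n -> P l.
Proof.
elim: n P => [|n IHn] P /=; first by move=> P0 [].
move=> /andP[/IHn Pt /IHn Pf] [//|b l] [sl].
by case: b; [apply: Pt | apply: Pf].
Qed.

Lemma mem_pairs N i j : (i < j < N)%N -> (i, j) \in pairs N.
Proof.
move=> ij; apply/allpairsPdep; exists i, j; rewrite !mem_iota; split=> //; lia.
Qed.

Lemma forces_admissible_search k M subs rks :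
  all (fun s => [&& size s == k, sorted ltn s & all (fun i => (i < M.+1)%N) s]) subs ->
  all_bits (size (pairs M.+1)) (find_ranked k M.+1 subs rks) ->
  forces_admissible k M.+1.
Proof.
move=> /allP subsP bits chi.
pose c i j := chi [set (inord i : 'I_M.+1); inord j].
have := all_bitsP bits (size_map (fun p => c p.1 p.2) (pairs M.+1)).
set l := map _ _ => /hasP[s /subsP/and3P[/eqP ss sorts /allP lts] /hasP[rk _ rkP]].
have colorE i j : (i < M.+1)%N -> (j < M.+1)%N -> i != j -> color M.+1 l i j = c i j.
  move=> iM jM ij; rewrite /color; case: ltnP => [ltij|leji].
    have ijP : (i, j) \in pairs M.+1 by rewrite mem_pairs // ltij.
    by rewrite (nth_map (0, 0)%N) ?index_mem // nth_index.
  have ijP : (j, i) \in pairs M.+1 by rewrite mem_pairs // ltn_neqAle eq_sym ij leji.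
  by rewrite (nth_map (0, 0)%N) ?index_mem // nth_index //= /c setUC.
have ltM (i : nat) : (i < k)%N -> (nth 0 s i < M.+1)%N.
  by move=> ik; apply/lts/mem_nth; rewrite ss.
have s_lt (i j : nat) : (i < j < k)%N -> (nth 0 s i < nth 0 s j)%N.
  move=> /andP[ij jk]; apply: (sorted_ltn_nth ltn_trans) => //; rewrite inE ss //.
  exact: ltn_trans jk.
have s_inj (i j : nat) : (i < k)%N -> (j < k)%N -> i != j -> nth 0%N s i != nth 0%N s j.
  move=> ik jk; rewrite !neq_ltn => /orP[ij|ji]; apply/orP; [left|right];
    by apply: s_lt; rewrite ?ij ?ji.
exists (fun i : 'I_k => inord (nth 0%N s i)) => [i j ij|].
  by rewrite ltEord /= !inordK ?ltM // s_lt // ij /=.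
apply: (@rank_acyclic _ _ (fun i : 'I_k => nth 0%N rk i)) => x y.
move=> /existsP[i /existsP[i' /and5P[/eqP ii' xi xi']]].
rewrite /induced_coloring !imsetU1 !imset_set1 => r /and3P[b b' yii'].
have ik : (i.+1 < k)%N by rewrite -ii' ltn_ord.
have iI : (i : nat) \in iota 0 k.-1 by rewrite mem_iota; move: ik; clear; lia.
have xI : (x : nat) \in iota 0 k by rewrite mem_iota /= add0n.
have /allP/(_ _ xI) := allP rkP _ iI.
have xi_nat : (x : nat) != i by rewrite val_eqE.
have xi'_nat : (x : nat) != i.+1 by rewrite -ii' val_eqE.
have {}colorE (a b0 : nat) : (a < k)%N -> (b0 < k)%N -> a != b0 ->
    color M.+1 l (nth 0 s a)%N (nth 0 s b0)%N = c (nth 0 s a)%N (nth 0 s b0)%N.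
  by move=> ak bk ab; rewrite colorE ?ltM ?s_inj.
have [ii_nat ix_nat i'x_nat] : [/\ (i : nat) != i.+1, (i : nat) != x & i.+1 != x].
  by rewrite ltn_eqF // eq_sym xi_nat eq_sym xi'_nat.
rewrite xi_nat xi'_nat !colorE //.
rewrite /c -ii' (eqP r) (eqP b) (eqP b') /= => /andP[lti lti'].
by case/orP: yii' => /eqP->.
Qed.

Lemma f_le k N : forces_admissible k N -> (f k <= N)%N.
Proof. by move=> H; rewrite /f; case: ex_minnP => m _; apply; apply/asboolP. Qed.

Lemma forces_admissible_3_3 : forces_admissible 3 3.
Proof.
by apply: (@forces_admissible_search 3 2 [:: iota 0 3] (permutations (iota 0 3))); lazy.
Qed.

(** All 1024 colorings are searched, with the five subsets that omit one vertex and the 24 possible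
    rankings. *)
Lemma forces_admissible_4_5 : forces_admissible 4 5.
Proof.
by apply: (@forces_admissible_search 4 4 [seq rem i (iota 0 5) | i <- iota 0 5]
  (permutations (iota 0 4))); lazy.
Qed.

(** With [l] the binary logarithm of [n] rounded up, [l.+1 * ln 2 <= 3 * ln n] for [n] at least 2;
    hence the constant [ln 2 / (3 * K)]. *)
Lemma biclique_size_bound (R : realType) (K : R) (n t : nat) : 1 <= K -> (0 < t)%N ->
  t%:R <= ln 2 / (3 * K) * n%:R / ln (n%:R : R) ->
  exists2 l, (0 < t <= 2 ^ l)%N & K * (t * l.+1)%:R <= n%:R.
Proof.
move=> K1 t_gt0 let_.
have K0 : 0 < K by apply: lt_le_trans K1.
have ln2 : 0 < ln 2 :> R by rewrite ln_gt0 // ltr1n.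
(* For [n] at most 1, [ln n] is 0 (also at 0) and the quotient by it is 0, against [t > 0]. *)
have n_gt1 : (1 < n)%N.
  rewrite ltnNge; apply/negP => len1.
  have ln0 : ln n%:R = 0 :> R.
    by case: n len1 {let_} => [|[|]] // _; [rewrite ln0 | rewrite ln1].
  by move: let_; rewrite ln0 invr0 mulr0 lern0; case: (t) t_gt0.
have ln_le : ln 2 <= ln n%:R :> R by rewrite ler_ln ?posrE ?ltr0n ?ler_nat // ltnW.
have lnn : 0 < ln n%:R :> R by apply: lt_le_trans ln_le.
have {}let_ : t%:R * ln n%:R * (3 * K) <= ln 2 * n%:R :> R.
  by move: let_; rewrite ler_pdivlMr // mulrAC ler_pdivlMr // mulr_gt0.
have [lo hi] := andP (up_log_bounds (isT : (1 < 2)%N) n_gt1).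
set l := up_log 2 n in lo hi.
have l_gt0 : (0 < l)%N by rewrite up_log_gt0.
have l1 : l.+1%:R * ln 2 <= 3 * ln n%:R :> R.
  (* This bounds [l.-1]; the two missing units are paid for by [ln 2 <= ln n]. *)
  have : ln ((2 ^ l.-1)%:R) <= ln n%:R :> R.
    by rewrite ler_ln ?posrE ?ltr0n ?expn_gt0 ?ler_nat ?(ltnW lo) // ltnW.
  rewrite natrX lnXn // -[ln 2 *+ _]mulr_natl.
  have -> : l.+1%:R = l.-1%:R + 2 :> R by rewrite -natrD addn2 prednK.
  by move: ln_le; clear; lra.
exists l.
  rewrite t_gt0 (leq_trans _ hi) // -(ler_nat R) -(ler_pM2l ln2).
  apply: le_trans let_; rewrite mulrC -mulrA ler_wpM2l //.
  by apply: le_trans ln_le _; rewrite ler_peMr ?(ltW lnn) //; move: K1; clear; lra.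
have ln3 : 0 < 3 * ln n%:R :> R by rewrite mulr_gt0.
rewrite natrM -(ler_pM2l ln3).
have -> : 3 * ln n%:R * (K * (t%:R * l.+1%:R)) = t%:R * ln n%:R * (3 * K) * l.+1%:R by ring.
apply: le_trans (ler_wpM2r (ler0n _ _) let_) _.
by rewrite mulrAC [ln 2 * _]mulrC ler_wpM2r.
Qed.

Theorem corollary3p3 (R : realType) :
  (f 3 <= 3)%N /\ (f 4 <= 5)%N /\
  forall eps : R, 0 < eps -> exists c : R, 0 < c /\
    (forall (d : Order.disp_t) (T : finOrderType d) (e : rel T),
       simple_graph e ->
       ~ has_induced_monotone_path 6 e ->
       eps < clique_density R 3 (complement e) ->
       contains_biclique (Num.truncn (c * #|T|%:R / ln (#|T|%:R : R)))
         (complement e)) /\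
    (forall (d : Order.disp_t) (T : finOrderType d) (e : rel T),
       simple_graph e ->
       ~ has_induced_monotone_path 8 e ->
       eps < clique_density R 5 (complement e) ->
       contains_biclique (Num.truncn (c * #|T|%:R / ln (#|T|%:R : R)))
         (complement e)).
Proof.
split; first exact: f_le forces_admissible_3_3.
split; first exact: f_le forces_admissible_4_5.
move=> eps eps0.
have [K1 K10 H1] := monotone_path_or_biclique forces_admissible_3_3 eps0.
have [K2 K20 H2] := monotone_path_or_biclique forces_admissible_4_5 eps0.
pose K := 1 + K1 + K2.
have K1K : K1 <= K by move: K20; rewrite /K; clear; lra.
have K2K : K2 <= K by move: K10; rewrite /K; clear; lra.
have K_ge1 : 1 <= K by move: K10 K20; rewrite /K; clear; lra.
have ln2 : 0 < ln 2 :> R by rewrite ln_gt0 // ltr1n.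
exists (ln 2 / (3 * K)); split.
  by rewrite divr_gt0 // mulr_gt0 // (lt_le_trans _ K_ge1).
have main d (T : finOrderType d) (e : rel T) (K0 : R) : K0 <= K ->
    (forall t l, (0 < t <= 2 ^ l)%N -> K0 * (t * l.+1)%:R <= #|T|%:R ->
       contains_biclique t (complement e)) ->
    contains_biclique (Num.truncn (ln 2 / (3 * K) * #|T|%:R / ln (#|T|%:R : R)))
      (complement e).
  (* For [t = 0] two empty sets suffice; this covers graphs on at most one vertex, where the
     logarithm vanishes. *)
  move=> K0K H; set t := Num.truncn _; case: (posnP t) => [->|t_gt0].
    exists set0, set0; rewrite cards0; split=> //; last by move=> x y; rewrite inE.
    by rewrite -setI_eq0 setI0.
  have [|l tl leK] := biclique_size_bound (n := #|T|) K_ge1 t_gt0.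
    by rewrite /t Num.Theory.truncn_le; move: t_gt0; rewrite Num.Theory.truncn_gt0; apply: le_trans.
  apply: H tl _; apply: le_trans leK; exact: ler_wpM2r.
split=> d T e gr np dense; apply: main.
- exact: K1K.
- by move=> t l; apply: H1.
- exact: K2K.
- by move=> t l; apply: H2.
Qed.
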